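(* $\mathcal{B}_F$ is an $\mathbb{N}$-graded pointed bialgebra with a PBW basis $$\{\widetilde{\omega}_m^{\,d}\,\mathcal{E}_{\omega_{n_1}}^{e_1}\cdots\mathcal{E}_{\omega_{n_j}}^{e_j}\mid m,j\ge 1,\ n_1>\cdots>n_j\ge 0,\ 0\le d\le 1,\ e_1,\ldots,e_j\ge 0\}$$ such that for $m,n,r,s\ge 0$ $$\mathcal{E}_{\omega_m}\mathcal{E}_{\omega_n}=\mathcal{E}_{\omega_n}\mathcal{E}_{\omega_m},\qquad \mathcal{E}_{\omega_m}\widetilde{\omega}_n=\sum_{k=0}^n\binom{n}{k}\widetilde{\omega}_{n-k}\mathcal{E}_{\omega_{m+k}},$$ $$\widetilde{\omega}_m\widetilde{\omega}_n=\sum_{k=0}^n\binom{n}{k}\widetilde{\omega}_{m+n-k}\mathcal{E}_{\omega_k},\qquad \widetilde{\omega}_r\mathcal{E}_{\omega_s}=\sum_{t=0}^s\binom{s}{t}(-1)^t\,\widetilde{\omega}_{r+t}\widetilde{\omega}_{s-t}.$$ Moreover, as the sub-bialgebra of $\mathcal{B}_F$, $\pi(\mathcal{B}_{\mathrm{FdB}}^{\mathrm{nc}})$ has a PBW basis $$\{1\}\cup\{\widetilde{\omega}_m\,\mathcal{E}_{\omega_{n_1}}^{e_1}\cdots\mathcal{E}_{\omega_{n_j}}^{e_j}\mid m,j\ge 1,\ n_1>\cdots>n_j\ge 0,\ e_1,\ldots,e_j\ge 0\}.$$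
   Context: $\mathbb{K}$ is a field, $\mathbb{N}=\{0,1,2,\ldots\}$, and $[a,b]=ab-ba$. On words in the letters $g,h$ use the lexicographic order with $g\prec h$ (a proper prefix of a word is smaller than the word). A Lyndon word is a nonempty word $\alpha$ which is a single letter or satisfies $\alpha\prec\gamma\beta$ for every factorization $\alpha=\beta\gamma$ into nonempty words. $\alpha(g)$ is the number of occurrences of $g$ in $\alpha$. The standard factorization of a Lyndon word $\alpha$ of length at least $2$ is $\alpha=\beta\gamma$ with $\beta,\gamma$ Lyndon and $\gamma$ of maximal length. Define $E_g=g$, $E_h=h$ and $E_\alpha=[E_\beta,E_\gamma]$ for the standard factorization $\alpha=\beta\gamma$. $\mathcal{T}=\mathbb{K}\langle g,h\rangle$ is the free algebra with bialgebra structure $\Delta(g)=g\otimes g$, $\Delta(h)=1\otimes h+h\otimes g$, $\epsilon(g)=1$, $\epsilon(h)=0$. $\pi:\mathcal{T}\to\overline{\mathcal{T}}=\mathcal{T}/\mathcal{I}$ is the quotient bialgebra map, where $\mathcal{I}$ is the ideal generated by all $E_\alpha$ with $\alpha$ Lyndon and $\alpha(g)\ge 2$. For $k\ge 0$, $\omega_k=gh^k$, so $E_{\omega_0}=g$ and $E_{\omega_k}=[E_{\omega_{k-1}},h]$ for $k\ge 1$. Put $\mathcal{E}_{\omega_k}=\pi(E_{\omega_k})$ and $\widetilde{\omega}_k=\pi(\omega_k)$; thus $\widetilde{\omega}_0=\mathcal{E}_{\omega_0}=\pi(g)$. $\mathcal{B}_F$ is the subalgebra of $\overline{\mathcal{T}}$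 generated by $\{\widetilde{\omega}_n,\mathcal{E}_{\omega_m}\mid n,m\ge 0\}$. The noncommutative Faà di Bruno bialgebra $\mathcal{B}_{\mathrm{FdB}}^{\mathrm{nc}}$ (the free algebra on $a_0,a_1,\ldots$ with $\epsilon(a_n)=\delta_{n,0}$, $\Delta(a_n)=\sum_{k=0}^n a_k\otimes\sum_{i_0+\cdots+i_k=n-k,\ i_0,\ldots,i_k\ge 0}a_{i_0}\cdots a_{i_k}$) is identified with the sub-bialgebra of $\mathcal{T}$ generated by $\{\omega_n\}_{n\ge 0}$ via $a_n\leftrightarrow\omega_n$; so $\pi(\mathcal{B}_{\mathrm{FdB}}^{\mathrm{nc}})$ is the subalgebra of $\overline{\mathcal{T}}$ generated by $\{\widetilde{\omega}_n\mid n\ge 0\}$. The grading is the one with $\deg\widetilde{\omega}_n=\deg\mathcal{E}_{\omega_n}=n$ (induced by $\deg g=0$, $\deg h=1$). A PBW basis means the displayed set of ordered monomials is a $\mathbb{K}$-vector space basis. A bialgebra is pointed if its coradical is spanned by grouplike elements.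
   Formalization: In the last basis, m ≥ 0 replaces m ≥ 1: with m ≥ 1 the displayed set does not span, since ω̃_0 = π(g) lies in π(B_FdB^nc) but sending g to X and h to 0 maps the span of 1 and those monomials to constants. *)

(* Defs.v *)
(* MathComp world: mathcomp, finmap and multinomials' monalg, with
   mathcomp-classical for sets as predicates. *)
From HB Require Import structures.
From mathcomp Require Import all_boot all_order all_algebra.
From mathcomp Require Import finmap monalg.
From mathcomp Require Import boolp classical_sets.

Set Implicit Arguments.
Unset Strict Implicit.
Unset Printing Implicit Defensive.

Import GRing.Theory.
Local Open Scope ring_scope.
Local Open Scope classical_set_scope.

Section LinearAlgebra.
Variables (K : fieldType) (V : lmodType K).

Definition is_subspace (S : set V) : Prop :=
  S 0 /\ forall (a : K) (u v : V), S u -> S v -> S (a *: u + v).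

Definition span (X : set V) : set V :=
  [set x | forall S, is_subspace S -> X `<=` S -> S x].

Definition lin_indep (X : set V) : Prop :=
  forall (s : seq V) (c : V -> K), uniq s -> (forall x, x \in s -> X x) ->
    \sum_(x <- s) c x *: x = 0 -> forall x, x \in s -> c x = 0.

Definition is_basis (B X : set V) : Prop := span X = B /\ lin_indep X.

Lemma span_subspace X : is_subspace (span X).
Proof.
split=> [S [] //|a u v Xu Xv S SS XS].
by apply: SS.2; [apply: Xu|apply: Xv].
Qed.

Lemma sub_span X : X `<=` span X.
Proof. by move=> x Xx S _; apply. Qed.

End LinearAlgebra.

Section Subalgebra.
Variables (K : fieldType) (A : algType K).

Definition is_subalgebra (S : set A) : Prop :=
  [/\ is_subspace S, S 1 & forall x y, S x -> S y -> S (x * y)].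

Definition subalg_gen (X : set A) : set A :=
  [set x | forall S, is_subalgebra S -> X `<=` S -> S x].

Definition is_ideal (S : set A) : Prop :=
  is_subspace S /\ forall a x, S x -> S (a * x) /\ S (x * a).

Definition ideal_gen (X : set A) : set A :=
  [set x | forall S, is_ideal S -> X `<=` S -> S x].

Lemma ideal_gen_ideal X : is_ideal (ideal_gen X).
Proof.
split=> [|a x Xx]; last first.
  by split=> S SS XS; have [] := SS.2 a _ (Xx S SS XS).
split=> [S [[]] //|a u v Xu Xv S SS XS].
by apply: SS.1.2; [apply: Xu|apply: Xv].
Qed.

End Subalgebra.

Section LmodQuotient.
Variables (K : fieldType) (V : lmodType K) (S : set V) (SS : is_subspace S).
Local Open Scope quotient_scope.

Definition mem_subspace (_ : is_subspace S) : {pred V} := fun x => `[< S x >].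

Fact mem_subspace_zmod_closed : zmod_closed (mem_subspace SS).
Proof.
split=> [|x y /asboolP Sx /asboolP Sy]; apply/asboolP; first exact: SS.1.
by rewrite addrC -scaleN1r; apply: SS.2.
Qed.

HB.instance Definition _ := GRing.isZmodClosed.Build V (mem_subspace SS)
  mem_subspace_zmod_closed.

Local Notation Q := {ideal_quot (mem_subspace SS)}.
Let qpi (x : V) : Q := \pi_Q x.
Let qrep (x : Q) : V := repr x.

Let qrepK x : qpi (qrep x) = x.
Proof. exact: reprK. Qed.

Let qpi_eq x y : qpi x = qpi y <-> S (x - y).
Proof.
split=> [/eqP|Sxy]; last apply/eqP; rewrite -Quotient.idealrBE.
  by move/asboolP.
exact/asboolP.
Qed.

Let qpiD x y : qpi (x + y) = qpi x + qpi y.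
Proof. exact: raddfD. Qed.

Definition qscale (a : K) (x : Q) : Q := qpi (a *: qrep x).

Let qpiZ a x : qpi (a *: x) = qscale a (qpi x).
Proof.
apply/qpi_eq; rewrite -scalerBr -[_ *: _]addr0.
by apply: SS.2 SS.1; apply/qpi_eq; rewrite qrepK.
Qed.

Fact qscaleA a b v : qscale a (qscale b v) = qscale (a * b) v.
Proof. by rewrite -[v]qrepK -!qpiZ scalerA. Qed.

Fact qscale1 : left_id 1 qscale.
Proof. by move=> v; rewrite -[v]qrepK -!qpiZ scale1r. Qed.

Fact qscaleDr : right_distributive qscale +%R.
Proof.
by move=> a u v; rewrite -[u]qrepK -[v]qrepK -qpiD -!qpiZ scalerDr qpiD.
Qed.

Fact qscaleDl v : {morph qscale^~ v : a b / a + b}.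
Proof. by move=> a b; rewrite -[v]qrepK -!qpiZ scalerDl qpiD. Qed.

(* The quotient module, the projection and a section of it, locked together to
   keep the unifier out of the construction. *)
Record lquot_data : Type := LquotData {
  lquot_car : lmodType K;
  lquot_pi : V -> lquot_car;
  lquot_rep : lquot_car -> V }.

Record is_lquot (d : lquot_data) : Prop := IsLquot {
  lquot_pi_linear : linear (lquot_pi d);
  lquot_repK : cancel (@lquot_rep d) (lquot_pi d);
  lquot_pi_eq : forall x y, lquot_pi d x = lquot_pi d y <-> S (x - y) }.

Definition lquot_impl : lquot_data :=
  let L := GRing.Zmodule_isLmodule.Build K Q qscaleA qscale1 qscaleDr qscaleDl in
  @LquotData (HB.pack_for (lmodType K) Q L) qpi qrep.

Fact lquot_implP : is_lquot lquot_impl.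
Proof.
split=> /= [a x y|x|x y]; last exact: qpi_eq; last exact: qrepK.
by rewrite -[RHS]/(qscale a (qpi x) + qpi y) -qpiZ -qpiD.
Qed.

Fact lquot_key : unit. Proof. by []. Qed.
Definition ldata : lquot_data := locked_with lquot_key lquot_impl.

Let ldataP : is_lquot ldata.
Proof. by rewrite /ldata unlock; apply: lquot_implP. Qed.

Definition lquot : Type := lquot_car ldata.

HB.instance Definition _ := GRing.Lmodule.on lquot.

Definition lpi : V -> lquot := lquot_pi ldata.
Definition lrep : lquot -> V := @lquot_rep ldata.

Fact lpi_linear : linear lpi.
Proof. exact: lquot_pi_linear. Qed.

HB.instance Definition _ := GRing.isLinear.Build K V lquot *:%R lpi lpi_linear.

Lemma lrepK : cancel lrep lpi.
Proof. exact: lquot_repK. Qed.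

Lemma lpi_eq x y : lpi x = lpi y <-> S (x - y).
Proof. exact: lquot_pi_eq. Qed.

End LmodQuotient.

Section AlgQuotient.
Variables (K : fieldType) (A : algType K) (J : set A).
Variables (JI : is_ideal J) (J1 : ~ J 1).

Definition aquot (I : is_ideal J) (_ : ~ J 1) : Type := lquot I.1.

Local Notation Q := (aquot JI J1).

HB.instance Definition _ := GRing.Lmodule.on Q.

Definition api (x : A) : Q := lpi JI.1 x.
Definition arep (x : Q) : A := lrep x.

Lemma arepK : cancel arep api.
Proof. exact: lrepK. Qed.

Lemma api_eq x y : api x = api y <-> J (x - y).
Proof. exact: lpi_eq. Qed.

Fact api_linear : linear api.
Proof. exact: lpi_linear. Qed.

HB.instance Definition _ := GRing.isLinear.Build K A Q *:%R api api_linear.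

Definition amul (x y : Q) : Q := api (arep x * arep y).

Fact apiM x y : api (x * y) = amul (api x) (api y).
Proof.
apply/api_eq; set x' := arep _; set y' := arep _.
have Ix : J (x - x') by apply/api_eq; rewrite arepK.
have Iy : J (y - y') by apply/api_eq; rewrite arepK.
have -> : x * y - x' * y' = 1 *: ((x - x') * y) + x' * (y - y').
  by rewrite scale1r mulrBl mulrBr addrA subrK.
apply: JI.1.2; first exact: (JI.2 y _ Ix).2.
exact: (JI.2 x' _ Iy).1.
Qed.

Fact amulA : associative amul.
Proof.
move=> x y z; rewrite -[x]arepK -[y]arepK -[z]arepK.
by rewrite -!apiM mulrA.
Qed.

Fact amul1l : left_id (api 1) amul.
Proof. by move=> x; rewrite -[x]arepK -apiM mul1r. Qed.

Fact amul1r : right_id (api 1) amul.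
Proof. by move=> x; rewrite -[x]arepK -apiM mulr1. Qed.

Fact amulDl : left_distributive amul +%R.
Proof.
move=> x y z; rewrite -[x]arepK -[y]arepK -[z]arepK.
by rewrite -raddfD -!apiM mulrDl raddfD.
Qed.

Fact amulDr : right_distributive amul +%R.
Proof.
move=> x y z; rewrite -[x]arepK -[y]arepK -[z]arepK.
by rewrite -raddfD -!apiM mulrDr raddfD.
Qed.

Fact api1_neq0 : api 1 != 0.
Proof.
by apply/eqP; rewrite -(raddf0 api) => /api_eq; rewrite subr0; apply: J1.
Qed.

HB.instance Definition _ := GRing.Zmodule_isNzRing.Build Q
  amulA amul1l amul1r amulDl amulDr api1_neq0.

Fact api_monoid_morphism : monoid_morphism api.
Proof. by split=> // x y; apply: apiM. Qed.

HB.instance Definition _ := GRing.isMonoidMorphism.Build A Q api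
  api_monoid_morphism.

Let apiZ a x : api (a *: x) = a *: api x.
Proof. exact: linearZ. Qed.

Let apiMr x y : api (x * y) = api x * api y.
Proof. exact: apiM. Qed.

Fact aquot_scalerAl (a : K) (x y : Q) : a *: (x * y) = a *: x * y.
Proof.
rewrite -[x]arepK -[y]arepK.
by rewrite -apiMr -!apiZ -apiMr -scalerAl.
Qed.

HB.instance Definition _ := GRing.Lmodule_isLalgebra.Build K Q aquot_scalerAl.

Fact aquot_scalerAr (a : K) (x y : Q) : a *: (x * y) = x * (a *: y).
Proof.
rewrite -[x]arepK -[y]arepK.
by rewrite -apiMr -!apiZ -apiMr -scalerAr.
Qed.

HB.instance Definition _ := GRing.Lalgebra_isAlgebra.Build K Q aquot_scalerAr.

End AlgQuotient.

Fact tensor_key : unit. Proof. by []. Qed.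

Section Tensor.
Variables (K : fieldType) (U V : lmodType K).

Local Notation F := {malg K[(U * V)%type]}.
Local Notation pure u v := (<< (u, v) >> : F).

Definition tensor_rel : set F :=
  [set x | (exists a u u' v,
              x = pure (a *: u + u') v - (a *: pure u v + pure u' v)) \/
           (exists a u v v',
              x = pure u (a *: v + v') - (a *: pure u v + pure u v'))].

Let Q : lmodType K := lquot (span_subspace tensor_rel).

Definition flift (W : lmodType K) (f : U -> V -> W) (x : F) : W :=
  \sum_(p <- msupp x) x@_p *: f p.1 p.2.

(* The carrier, the pure tensors and the universal maps, locked together to
   keep the unifier out of the quotient. *)
Record tensor_data : Type := TensorData {
  tcar : lmodType K;
  tpure : U -> V -> tcar;
  tuniv : forall W : lmodType K, (U -> V -> W) -> tcar -> W }.

Definition tensor_impl : tensor_data :=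
  @TensorData Q (fun u v => lpi _ (pure u v)) (fun W f t => flift f (lrep t)).

Section Lift.
Variables (W : lmodType K) (f : U -> V -> W).

Fact fliftEw (d : {fset U * V}) x : (msupp x `<=` d)%fset ->
  flift f x = \sum_(p <- d) x@_p *: f p.1 p.2.
Proof.
move=> le; rewrite /flift (big_fset_incl _ le) //= => p _ /mcoeff_outdom ->.
by rewrite scale0r.
Qed.

Fact flift_linear : linear (flift f).
Proof.
move=> a x y; set d := (msupp x `|` msupp y)%fset.
rewrite !(@fliftEw d) ?fsubsetUl ?fsubsetUr //; last first.
  by apply: fsubset_trans (msuppD_le _ _) _; apply: fsetSU; apply: msuppZ_le.
rewrite scaler_sumr -big_split /=; apply: eq_bigr => p _.
by rewrite mcoeffD mcoeffZ scalerDl scalerA.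
Qed.

HB.instance Definition _ :=
  GRing.isLinear.Build K F W *:%R (flift f) flift_linear.

Fact flift_pure u v : flift f (pure u v) = f u v.
Proof. by rewrite (fliftEw (msuppU_le)) big_seq_fset1 mcoeffUU scale1r. Qed.

Hypotheses (fl : forall v, linear (f^~ v)) (fr : forall u, linear (f u)).

Fact flift_pi x : flift f (lrep (lpi (span_subspace tensor_rel) x)) = flift f x.
Proof.
apply/eqP; rewrite -subr_eq0 -linearB /=; apply/eqP.
have: span tensor_rel (lrep (lpi (span_subspace tensor_rel) x) - x).
  by apply/(lpi_eq (span_subspace _)); rewrite lrepK.
move=> /(_ [set y | flift f y = 0]); apply=> [|y []].
- split=> [|a y z fy fz] /=; first exact: linear0.
  by rewrite flift_linear fy fz scaler0 addr0.
- move=> [a [u [u' [v ->]]]] /=.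
  by rewrite linearB linearP /= !flift_pure fl subrr.
- move=> [a [u [v [v' ->]]]] /=.
  by rewrite linearB linearP /= !flift_pure fr subrr.
Qed.

End Lift.

Record is_tensor (d : tensor_data) : Prop := IsTensor {
  tensor_linearl : forall v, linear ((tpure d)^~ v);
  tensor_linearr : forall u, linear (tpure d u);
  tensor_univ_linear : forall (W : lmodType K) (f : U -> V -> W),
    (forall v, linear (f^~ v)) -> (forall u, linear (f u)) ->
    linear (@tuniv d W f);
  tensor_univ_pure : forall (W : lmodType K) (f : U -> V -> W),
    (forall v, linear (f^~ v)) -> (forall u, linear (f u)) ->
    forall u v, @tuniv d W f (tpure d u v) = f u v;
  tensor_spanned : forall P : tcar d -> Prop,
    (forall a x y, P x -> P y -> P (a *: x + y)) ->
    (forall u v, P (tpure d u v)) -> forall t, P t }.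

Fact tensor_implP : is_tensor tensor_impl.
Proof.
split=> /= [v a u u'|u a v v'|W f fl fr a x y|W f fl fr u v|P PD PT t].
- rewrite -linearP; apply/lpi_eq; apply: sub_span.
  by left; exists a, u, u', v.
- rewrite -linearP; apply/lpi_eq; apply: sub_span.
  by right; exists a, u, v, v'.
- rewrite -[x]lrepK -[y]lrepK -linearP !flift_pi //.
  exact: flift_linear.
- by rewrite flift_pi // flift_pure.
have P0 : P 0 by rewrite -(addNr (lpi _ (pure 0 0))) -scaleN1r; apply: PD.
rewrite -[t]lrepK (monalgE (lrep t)) raddf_sum /=.
elim/big_rec: _ => // -[u v] x _ Px.
have -> : << (lrep t)@_(u, v) *g (u, v) >> = (lrep t)@_(u, v) *: pure u v.
  by apply/malgP=> k; rewrite mcoeffZ !mcoeffU mulr_natr.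
by rewrite linearZ; apply: PD => //; apply: PT.
Qed.

Definition tdata : tensor_data := locked_with tensor_key tensor_impl.

Let tdataP : is_tensor tdata.
Proof. by rewrite /tdata unlock; apply: tensor_implP. Qed.

Definition tensor : Type := tcar tdata.

HB.instance Definition _ := GRing.Lmodule.on tensor.

Definition tens : U -> V -> tensor := tpure tdata.

(* The linear map induced by [f], when [f] is bilinear. *)
Definition tlift (W : lmodType K) (f : U -> V -> W) : tensor -> W :=
  @tuniv tdata W f.

Lemma tens_linearl v : linear (tens^~ v).
Proof. exact: tensor_linearl. Qed.

Lemma tens_linearr u : linear (tens u).
Proof. exact: tensor_linearr. Qed.

Lemma tlift_linear (W : lmodType K) (f : U -> V -> W) :
  (forall v, linear (f^~ v)) -> (forall u, linear (f u)) -> linear (tlift f).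
Proof. exact: tensor_univ_linear. Qed.

Lemma tlift_tens (W : lmodType K) (f : U -> V -> W) :
  (forall v, linear (f^~ v)) -> (forall u, linear (f u)) ->
  forall u v, tlift f (tens u v) = f u v.
Proof. exact: tensor_univ_pure. Qed.

Lemma tensor_ind (P : tensor -> Prop) :
  (forall a x y, P x -> P y -> P (a *: x + y)) -> (forall u v, P (tens u v)) ->
  forall t, P t.
Proof. exact: tensor_spanned. Qed.

End Tensor.

Arguments tensor {K} U V.

Notation "u \ox v" := (tens u v) (at level 40, left associativity) : ring_scope.

Fact linear_swap (K : fieldType) (V : lmodType K) (a b : K) (x y z w : V) :
  a *: (b *: x + y) + (b *: z + w) = b *: (a *: x + z) + (a *: y + w).
Proof. by rewrite !scalerDr addrACA !scalerA [a * b]mulrC. Qed.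

Section TensorAlgebra.
Variables (K : fieldType) (A B : algType K).

Definition tmul_pure (y : tensor A B) (a : A) (b : B) : tensor A B :=
  tlift (fun a' b' => (a * a') \ox (b * b')) y.

Definition tmul (x y : tensor A B) : tensor A B :=
  tlift (tmul_pure y) x.

Let mul_linl (a : A) (b b' : B) : linear (fun a' => (a * a') \ox (b * b')).
Proof. by move=> c u v; rewrite mulrDr -scalerAr tens_linearl. Qed.

Let mul_linr (a a' : A) (b : B) : linear (fun b' => (a * a') \ox (b * b')).
Proof. by move=> c u v; rewrite mulrDr -scalerAr tens_linearr. Qed.

Let inner_tens a b a' b' : tmul_pure (a' \ox b') a b = (a * a') \ox (b * b').
Proof. exact: (tlift_tens (mul_linl a b) (fun a' => mul_linr a a' b)). Qed.

Let inner_linear a b : linear (fun y => tmul_pure y a b).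
Proof. exact: (tlift_linear (mul_linl a b) (fun a' => mul_linr a a' b)). Qed.

Let inner_linl y b : linear (fun a => tmul_pure y a b).
Proof.
move=> c u v; elim/tensor_ind: y => [d x y Hx Hy|p q].
  rewrite !inner_linear Hx Hy; apply: linear_swap.
by rewrite !inner_tens mulrDl -scalerAl tens_linearl.
Qed.

Let inner_linr y a : linear (tmul_pure y a).
Proof.
move=> c u v; elim/tensor_ind: y => [d x y Hx Hy|p q].
  rewrite !inner_linear Hx Hy; apply: linear_swap.
by rewrite !inner_tens mulrDl -scalerAl tens_linearr.
Qed.

Let tmul_tensl a b y : tmul (a \ox b) y = tmul_pure y a b.
Proof. exact: (tlift_tens (inner_linl y) (inner_linr y)). Qed.

Lemma tmul_tens a b a' b' :
  tmul (a \ox b) (a' \ox b') = (a * a') \ox (b * b').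
Proof. by rewrite tmul_tensl inner_tens. Qed.

Lemma tmul_linearl y : linear (tmul^~ y).
Proof. exact: (tlift_linear (inner_linl y) (inner_linr y)). Qed.

Lemma tmul_linearr x : linear (tmul x).
Proof.
move=> c y z; elim/tensor_ind: x => [d x x' Hx Hx'|a b]; last first.
  by rewrite !tmul_tensl inner_linear.
rewrite (tmul_linearl (c *: y + z) d x x') Hx Hx'.
rewrite (tmul_linearl y d x x') (tmul_linearl z d x x'); apply: linear_swap.
Qed.

Lemma tmulA : associative tmul.
Proof.
move=> x y z; elim/tensor_ind: x => [d x x' Hx Hx'|a b].
  rewrite (tmul_linearl (tmul y z) d x x') Hx Hx'.
  by rewrite (tmul_linearl y d x x') (tmul_linearl z d).
elim/tensor_ind: y => [d y y' Hy Hy'|a' b'].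
  rewrite (tmul_linearl z d y y').
  rewrite (tmul_linearr (a \ox b) d (tmul y z) (tmul y' z)) Hy Hy'.
  by rewrite (tmul_linearr (a \ox b) d y y') (tmul_linearl z d).
elim/tensor_ind: z => [d z z' Hz Hz'|a'' b''].
  rewrite (tmul_linearr (a' \ox b') d z z').
  rewrite (tmul_linearr (a \ox b) d (tmul (a' \ox b') z)) Hz Hz'.
  by rewrite (tmul_linearr (tmul (a \ox b) (a' \ox b')) d).
by rewrite !tmul_tens !mulrA.
Qed.

Lemma tmul1 : left_id (1 \ox 1) tmul.
Proof.
elim/tensor_ind => [d x y Hx Hy|a b]; first by rewrite (tmul_linearr _ d) Hx Hy.
by rewrite tmul_tens !mul1r.
Qed.

Lemma tmulr1 : right_id (1 \ox 1) tmul.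
Proof.
elim/tensor_ind => [d x y Hx Hy|a b]; first by rewrite (tmul_linearl _ d) Hx Hy.
by rewrite tmul_tens !mulr1.
Qed.

Lemma tmulDl : left_distributive tmul +%R.
Proof. by move=> x y z; have := tmul_linearl z 1 x y; rewrite !scale1r. Qed.

Lemma tmulDr : right_distributive tmul +%R.
Proof. by move=> x y z; have := tmul_linearr x 1 y z; rewrite !scale1r. Qed.

(* The library's algebra structures would require [1 != 0], which is not needed
   here: [tensor A B] is equipped with its module and its ring structure only. *)
HB.instance Definition _ := GRing.Zmodule_isPzRing.Build (tensor A B)
  tmulA tmul1 tmulr1 tmulDl tmulDr.

End TensorAlgebra.

Section Coalgebra.
Variables (K : fieldType) (C : lmodType K).
Variables (Delta : C -> tensor C C) (eps : C -> K).

Definition tmap (U V U' V' : lmodType K) (f : U -> U') (g : V -> V') :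
    tensor U V -> tensor U' V' :=
  tlift (fun u v => f u \ox g v).

Definition tassoc (U V W : lmodType K) :
    tensor (tensor U V) W -> tensor U (tensor V W) :=
  tlift (fun t w => tlift (fun u v => u \ox (v \ox w)) t).

Record is_coalgebra : Prop := IsCoalgebra {
  comul_linear : linear Delta;
  counit_linear : scalar eps;
  comulA : forall x,
    tassoc (tmap Delta id (Delta x)) = tmap id Delta (Delta x);
  counitl : forall x, tlift (fun u v => eps u *: v) (Delta x) = x;
  counitr : forall x, tlift (fun u v => eps v *: u) (Delta x) = x }.

(* The image of [P (x) Q] in the tensor square, for subspaces [P] and [Q];
   over a field [P (x) Q] embeds in it. *)
Definition tens_sub (P Q : set C) : set (tensor C C) :=
  span [set t | exists u v, [/\ P u, Q v & t = u \ox v]].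

Definition is_subcoalgebra (D : set C) : Prop :=
  is_subspace D /\ forall x, D x -> tens_sub D D (Delta x).

Definition is_simple_coalgebra (D : set C) : Prop :=
  [/\ is_subcoalgebra D, D <> [set 0]
    & forall D', is_subcoalgebra D' -> D' `<=` D -> D' = [set 0] \/ D' = D].

(* The coradical of the subcoalgebra [B]: the sum of its simple
   subcoalgebras. *)
Definition coradical (B : set C) : set C :=
  span [set x | exists D, [/\ is_simple_coalgebra D, D `<=` B & D x]].

Definition grouplike (x : C) : Prop := Delta x = x \ox x /\ eps x = 1.

Definition is_pointed (B : set C) : Prop :=
  coradical B = span [set x | B x /\ grouplike x].

End Coalgebra.

Section Bialgebra.
Variables (K : fieldType) (A : algType K).
Variables (Delta : A -> tensor A A) (eps : A -> K).

Record is_bialgebra : Prop := IsBialgebra {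
  bialg_coalg : is_coalgebra Delta eps;
  comul_morphism : monoid_morphism Delta;
  counit_morphism : monoid_morphism eps }.

Definition is_subbialgebra (B : set A) : Prop :=
  is_subalgebra B /\ is_subcoalgebra Delta B.

Record is_grading (B : set A) (Bn : nat -> set A) : Prop := IsGrading {
  grade_subspace : forall n, is_subspace (Bn n);
  grade_sub : forall n, Bn n `<=` B;
  grade_span : forall x, B x -> exists N (y : nat -> A),
    (forall n, Bn n (y n)) /\ x = \sum_(n < N) y n;
  grade_direct : forall N (y : nat -> A),
    (forall n, Bn n (y n)) -> \sum_(n < N) y n = 0 ->
    forall n, (n < N)%N -> y n = 0;
  grade_one : Bn 0%N 1;
  grade_mul : forall m n x y, Bn m x -> Bn n y -> Bn (m + n)%N (x * y);
  grade_comul : forall n x, Bn n x ->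
    span [set t | exists i u v,
            [/\ (i <= n)%N, Bn i u, Bn (n - i)%N v & t = u \ox v]] (Delta x);
  grade_counit : forall n x, (0 < n)%N -> Bn n x -> eps x = 0 }.

End Bialgebra.

Section LyndonWords.

Definition letter_g : bool := false.
Definition letter_h : bool := true.

(* [seqlexi] carries the lexicographic order, with [false < true] and proper
   prefixes smaller; [rot i w] is [gamma ++ beta] for the factorization of [w]
   into [beta = take i w] and [gamma = drop i w]. *)
Definition lyndon (w : seq bool) : bool :=
  (w != [::]) && all (fun i => ((w : seqlexi bool) < rot i w)%O)
                     (iota 1 (size w).-1).

(* The least [i] such that [take i w] and [drop i w] are Lyndon: [drop i w] has
   maximal length. *)
Definition std_index (w : seq bool) : nat :=
  find (fun i => lyndon (take i w) && lyndon (drop i w)) (iota 0 (size w)).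

Definition omega (k : nat) : seq bool := letter_g :: nseq k letter_h.

End LyndonWords.

Fact malg_scalerAr (K : fieldType) (G : monomType) (a : K)
  (x y : {malg K[G]}) : a *: (x * y) = x * (a *: y).
Proof.
rewrite [x * y]malgME [x * (a *: y)](malgMEw (fsubset_refl _) (msuppZ_le a y)).
rewrite scaler_sumr; apply: eq_bigr => k _.
rewrite scaler_sumr; apply: eq_bigr => l _.
apply/malgP => m; rewrite [LHS]mcoeffZ !mcoeffU [(a *: y)@_l]mcoeffZ.
by rewrite mulrnAr mulrCA.
Qed.

Definition free_alg (K : fieldType) : Type := {malg K[{fmonom bool}]}.

Section FreeAlgebra.
Variable K : fieldType.
Local Notation T := (free_alg K).

HB.instance Definition _ := GRing.Lalgebra.on T.

Fact free_alg_scalerAr (a : K) (x y : T) : a *: (x * y) = x * (a *: y).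
Proof. exact: malg_scalerAr. Qed.

HB.instance Definition _ := GRing.Lalgebra_isAlgebra.Build K T
  free_alg_scalerAr.

Definition word (w : seq bool) : T := << FMonom w >>.
Definition gT : T := word [:: letter_g].
Definition hT : T := word [:: letter_h].

Definition commutator (A : algType K) (a b : A) : A := a * b - b * a.

(* The factors of a factorization are shorter than the word, so the recursion
   depth [size w] is enough. *)
Fixpoint Elyn_rec (n : nat) (w : seq bool) : T :=
  if n is n'.+1 then
    if (size w <= 1)%N then word w
    else commutator (Elyn_rec n' (take (std_index w) w))
                    (Elyn_rec n' (drop (std_index w) w))
  else word w.
Definition Elyn (w : seq bool) : T := Elyn_rec (size w) w.

Definition DeltaT_letter (l : bool) : tensor T T :=
  if l == letter_g then gT \ox gT else 1 \ox hT + hT \ox gT.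

Definition DeltaT (x : T) : tensor T T :=
  \sum_(w <- msupp x) x@_w *: \prod_(l <- (w : seq bool)) DeltaT_letter l.

Definition epsT_word (w : {fmonom bool}) : K :=
  \prod_(l <- (w : seq bool)) (l == letter_g)%:R.

Fact epsT_word_morphism : mmorphism epsT_word.
Proof.
by split=> [u v|]; rewrite /epsT_word ?fmM ?fm1 ?big_cat ?big_nil.
Qed.
HB.instance Definition _ := isMultiplicative.Build {fmonom bool} K epsT_word
  epsT_word_morphism.

Definition epsT : T -> K := mmap idfun epsT_word.

Definition relT : set T :=
  [set x | exists w, [/\ lyndon w, (2 <= count_mem letter_g w)%N & x = Elyn w]].

Definition idealT : set T := ideal_gen relT.

Fact epsT_mul x y : epsT (x * y) = epsT x * epsT y.
Proof. exact: (rmorphM (mmap idfun epsT_word)). Qed.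

Fact epsT_linear : scalar epsT.
Proof.
move=> a x y; rewrite -(mmapZ (h := epsT_word) (f := idfun)).
exact: (raddfD (mmap idfun epsT_word)).
Qed.
HB.instance Definition _ := GRing.isLinear.Build K T K *%R epsT epsT_linear.

Fact epsT_commutator x y : epsT (commutator x y) = 0.
Proof.
rewrite /commutator; have -> := raddfB epsT (x * y) (y * x).
by rewrite [X in X - _]epsT_mul [X in _ - X]epsT_mul mulrC subrr.
Qed.

Fact Elyn_recE n w : (1 < size w)%N ->
  Elyn_rec n.+1 w = commutator (Elyn_rec n (take (std_index w) w))
                               (Elyn_rec n (drop (std_index w) w)).
Proof. by rewrite /= ltnNge => /negbTE ->. Qed.

Fact epsT_relT x : relT x -> epsT x = 0.
Proof.
move=> [w [_ w2 ->]]; have w1 := leq_trans w2 (count_size _ _).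
rewrite /Elyn -(prednK (ltnW w1)) Elyn_recE //; exact: epsT_commutator.
Qed.

Fact one_notin_idealT : ~ idealT 1.
Proof.
move=> /(_ [set x | epsT x = 0]) H.
have : epsT 1 = 0.
  apply: H => [|x /epsT_relT//].
  split=> [|a x /= x0].
    split=> [|a u v /= u0 v0]; first exact: linear0.
    by rewrite linearP /= u0 v0 mulr0 addr0.
  by split; [rewrite (epsT_mul a x) x0 mulr0|rewrite (epsT_mul x a) x0 mul0r].
by rewrite [epsT _](rmorph1 (mmap idfun epsT_word)) => /eqP; rewrite oner_eq0.
Qed.

Definition Tbar : Type := aquot (ideal_gen_ideal relT) one_notin_idealT.

HB.instance Definition _ := GRing.Algebra.on Tbar.

Definition proj : T -> Tbar :=
  @api _ _ _ (ideal_gen_ideal relT) one_notin_idealT.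
Definition rep : Tbar -> T :=
  @arep _ _ _ (ideal_gen_ideal relT) one_notin_idealT.

HB.instance Definition _ := GRing.LRMorphism.on proj.

(* The structure maps of the quotient are defined on representatives; that they
   do not depend on the choice is the assertion [DeltaTbar \o proj = ...]. *)
Definition DeltaTbar (x : Tbar) : tensor Tbar Tbar :=
  tmap proj proj (DeltaT (rep x)).
Definition epsTbar (x : Tbar) : K := epsT (rep x).

Definition is_quotient_bialgebra : Prop :=
  [/\ is_bialgebra DeltaTbar epsTbar,
      forall x, DeltaTbar (proj x) = tmap proj proj (DeltaT x)
    & forall x, epsTbar (proj x) = epsT x].

Definition omegat (n : nat) : Tbar := proj (word (omega n)).
Definition Eomega (n : nat) : Tbar := proj (Elyn (omega n)).

Definition BF : set Tbar :=
  subalg_gen [set x | exists n, x = omegat n \/ x = Eomega n].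

Definition homogT (n : nat) : set T :=
  [set x | forall w : {fmonom bool},
             w \in msupp x -> count_mem letter_h w = n].

Definition BF_deg (n : nat) : set Tbar := BF `&` (proj @` homogT n).

Definition BFdB : set T := subalg_gen [set x | exists n, x = word (omega n)].

(* A nonempty list [s] of pairs [(n_i, e_i)] with decreasing [n_i] encodes
   [E_(omega_(n_1))^e_1 ... E_(omega_(n_j))^e_j]; the [e_i] may vanish. *)
Definition decreasing_exps (s : seq (nat * nat)) : bool :=
  (0 < size s)%N && sorted (fun p q => q.1 < p.1)%N s.

Definition Emonom (s : seq (nat * nat)) : Tbar :=
  \prod_(p <- s) Eomega p.1 ^+ p.2.

Definition PBW_BF : set Tbar :=
  [set x | exists m d s, [/\ (1 <= m)%N, (d <= 1)%N, decreasing_exps s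
                           & x = omegat m ^+ d * Emonom s]].

(* Here [m = 0] must be allowed: [omegat 0 = proj gT] belongs to
   [proj @` BFdB], but is not in the span of [1] and of the monomials with
   [1 <= m] (send [g] to ['X] and [h] to [0] in [{poly K}]). *)
Definition PBW_BFdB : set Tbar :=
  [set x | x = 1 \/ exists m s, decreasing_exps s /\ x = omegat m * Emonom s].

End FreeAlgebra.

(* Main.v *)
From HB Require Import structures.
Require Import Defs.
From mathcomp Require Import all_boot all_order all_algebra.
From mathcomp Require Import finmap monalg.
From mathcomp Require Import boolp classical_sets functions.

Set Implicit Arguments.
Unset Strict Implicit.
Unset Printing Implicit Defensive.

Import GRing.Theory.
Local Open Scope ring_scope.
Local Open Scope classical_set_scope.
Import Order.SeqLexiOrder.Exports Order.POrderTheory.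

Local Notation span := Defs.span.
Local Notation sub_span := Defs.sub_span.

(** Write a_0 = g and a_(k+1) = a_k h - h a_k, in the free algebra (where a_k is
    E_(omega_k)) and in its quotient.

    The ideal.  A Lyndon word with at least two letters g has a standard factor
    of the same kind, or is a product omega_i omega_j.  Hence the ideal of
    relations is generated by the commutators [a_i, a_j] (lemmas [idealT_sub] and
    [Elyn_omega_cat]), and the quotient is the Ore extension K[a_0, a_1, ...][h]
    with a_k h = h a_k + a_(k+1).  This gives the quotient a universal property:
    operators for g and h on a vector space extend to a right action of the
    quotient as soon as their iterated brackets commute ([Tbar_act]).  The
    comultiplication, the grading and a representation by polynomials are all
    obtained from it.

    The relations.  They are the Leibniz formula
    a_m h^n = sum_k C(n,k) h^(n-k) a_(m+k) and its inverse
    a_s = sum_t (-1)^t C(s,t) h^t g h^(s-t), multiplied by g h^i on the left.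

    The coproduct.  Let E be the commutative algebra generated by the a_k.
    Taking the bracket with Delta(h) = 1 (x) h + h (x) g preserves E (x) E, since
    [u (x) v, Delta(h)] = u (x) [v,h] + [u,h] (x) v g whenever v commutes with g.
    So the images of the a_k commute in the tensor square, and Delta descends to
    the quotient ([iter_tbracketC]).  The same computation, with degrees, gives
    the graded form of Delta(a_n); that of Delta(g h^n) comes from multiplying
    by Delta(h) step by step ([comul_e_graded], [comul_w_graded]).

    The bases.  The relations show that the spans of the two families of
    monomials are stable under left multiplication by the generators, hence are
    the whole algebras ([ext_basis_span], [fdb_basis_span]).  For the
    independence, let g act on K[X_0, X_1, ...] by multiplication by X_1, and h
    by X_0 + delta with delta the derivation sending X_0 to 0 and X_(k+1) to
    X_(k+2).  Then a_k acts by X_(k+1), and g h^m a^mu sends 1 to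
    X_0^m X_1 X^mu plus terms of lower degree in X_0, so that the images are
    triangular ([triangular_indep], [ext_basis_indep]).

    Pointedness.  Let C be a nonzero subcoalgebra of B_F, x a nonzero element of
    C and n the top degree of x.  Applying to the left factor of Delta(x) a
    functional that factors through the projection to degree n yields an element
    of C of degree 0, that is, a polynomial in g.  It can be chosen nonzero,
    because its counit is the value of the functional on x.  A second functional
    extracts a single power of g.  So C contains a grouplike element
    ([subcoalg_gX]), and a simple C is the line it spans. *)

(** * Subspaces, spans and subalgebras *)

Section Subspaces.
Variable K : fieldType.
Implicit Types V W : lmodType K.

Lemma span_sub V (X S : set V) : is_subspace S -> X `<=` S -> span X `<=` S.
Proof. by move=> SS XS x; apply. Qed.

Lemma spanS V (X Y : set V) : X `<=` Y -> span X `<=` span Y.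
Proof.
by move=> XY; apply: span_sub (span_subspace Y) _ => x /XY; apply: sub_span.
Qed.

Section Subspace.
Variables (V : lmodType K) (S : set V).
Hypothesis SS : is_subspace S.

Lemma subspace0 : S 0. Proof. exact: SS.1. Qed.

Lemma subspaceD x y : S x -> S y -> S (x + y).
Proof. by move=> Sx Sy; rewrite -[x]scale1r; apply: SS.2. Qed.

Lemma subspaceZ a x : S x -> S (a *: x).
Proof. by move=> Sx; rewrite -[_ *: _]addr0; apply: SS.2 => //; apply: SS.1. Qed.

Lemma subspaceB x y : S x -> S y -> S (x - y).
Proof. by move=> Sx Sy; rewrite addrC -scaleN1r; apply: SS.2. Qed.

Lemma subspaceMn x n : S x -> S (x *+ n).
Proof. by move=> Sx; rewrite -scaler_nat; apply: subspaceZ. Qed.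

Lemma subspace_sum (I : Type) (r : seq I) (P : pred I) (F : I -> V) :
  (forall i, P i -> S (F i)) -> S (\sum_(i <- r | P i) F i).
Proof.
move=> SF; elim/big_rec: _ => [|i x Pi Sx]; first exact: subspace0.
by apply: subspaceD => //; apply: SF.
Qed.

End Subspace.

Lemma preim_subspace V W (f : V -> W) (S : set W) :
  linear f -> is_subspace S -> is_subspace [set x | S (f x)].
Proof.
move=> fl SS; split=> [|a u v Su Sv] /=; last by rewrite fl; apply: SS.2.
have -> : f 0 = f (-1 *: 0 + 0) by rewrite scaler0 addr0.
by rewrite fl scaleN1r addNr; apply: SS.1.
Qed.

Lemma linear_fun0 V W (f : V -> W) : linear f -> f 0 = 0.
Proof. by move=> fl; have := fl (-1) 0 0; rewrite scaler0 addr0 scaleN1r addNr. Qed.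

Lemma linear_funZ V W (f : V -> W) : linear f -> forall a x, f (a *: x) = a *: f x.
Proof. by move=> fl a x; rewrite -[a *: x]addr0 fl (linear_fun0 fl) addr0. Qed.

Lemma linear_funD V W (f : V -> W) : linear f -> forall x y, f (x + y) = f x + f y.
Proof. by move=> fl x y; rewrite -[x in LHS]scale1r fl scale1r. Qed.

Lemma linear_funB V W (f : V -> W) : linear f -> forall x y, f (x - y) = f x - f y.
Proof. by move=> fl x y; rewrite addrC -scaleN1r fl scaleN1r addrC. Qed.

Lemma linear_funMn V W (f : V -> W) : linear f -> forall x n, f (x *+ n) = f x *+ n.
Proof. by move=> fl x n; rewrite -!scaler_nat linear_funZ. Qed.

Lemma linear_fun_sum V W (f : V -> W) : linear f ->
  forall (I : Type) (r : seq I) (P : pred I) (F : I -> V),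
  f (\sum_(i <- r | P i) F i) = \sum_(i <- r | P i) f (F i).
Proof.
move=> fl I r P F; elim/big_rec2: _ => [|i y x _ <-]; first exact: linear_fun0.
by rewrite linear_funD.
Qed.

Lemma span_image V W (f : V -> W) (X : set V) (Y : set W) :
  linear f -> (forall x, X x -> span Y (f x)) -> forall x, span X x -> span Y (f x).
Proof.
by move=> fl XY; apply: span_sub (preim_subspace fl (span_subspace Y)) XY.
Qed.

Lemma span_expand V (X : set V) x : span X x ->
  exists (s : seq V) (c : V -> K),
    [/\ uniq s, forall y, y \in s -> X y & x = \sum_(y <- s) c y *: y].
Proof.
move=> /(_ [set x | exists (s : seq V) (c : V -> K),
  [/\ uniq s, forall y, y \in s -> X y & x = \sum_(y <- s) c y *: y]]).
apply=> [|y Xy]; last first.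
  exists [:: y], (fun=> 1).
  by split=> [//|z|]; rewrite ?inE ?big_seq1 ?scale1r // => /eqP->.
split=> [|a u v [s [c [su sX ->]]] [t [d [tu tX ->]]]].
  by exists [::], (fun=> 0); rewrite big_nil.
pose c' y := if y \in s then c y else 0.
pose d' y := if y \in t then d y else 0.
have ext (r r' : seq V) (f : V -> K) : uniq r -> uniq r' -> {subset r <= r'} ->
    \sum_(y <- r) f y *: y = \sum_(y <- r') (if y \in r then f y else 0) *: y.
  move=> ru r'u rr'; rewrite (perm_big (filter (mem r) r')) /=; last first.
    apply: uniq_perm => // [|z]; first exact: filter_uniq.
    by rewrite mem_filter /=; case zr: (z \in r); rewrite //= rr'.
  rewrite big_filter [RHS](bigID (mem r)) /= [X in _ + X]big1 ?addr0.
    by apply: eq_bigr => y /= ->.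
  by move=> y /= /negPf ->; rewrite scale0r.
exists (undup (s ++ t)), (fun y => a * c' y + d' y).
split=> [|y|]; first exact: undup_uniq.
  by rewrite mem_undup mem_cat => /orP [/sX|/tX].
rewrite (ext s (undup (s ++ t))) ?undup_uniq //; last first.
  by move=> y ys; rewrite mem_undup mem_cat ys.
rewrite (ext t (undup (s ++ t))) ?undup_uniq //; last first.
  by move=> y ys; rewrite mem_undup mem_cat ys orbT.
rewrite scaler_sumr -big_split /=; apply: eq_bigr => y _.
by rewrite scalerDl scalerA.
Qed.

Lemma lin_indepS V (X Y : set V) : X `<=` Y -> lin_indep Y -> lin_indep X.
Proof. by move=> XY LY s c su sX; apply: LY => // x /sX /XY. Qed.

(** Triangularity of a set [X] of vectors with respect to a rank: the functional
    [f x] detects [x] among the elements of [X] of rank at most [rk x]. *)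
Section Triangular.
Variables (V : lmodType K) (X : set V) (f : V -> V -> K) (rk : V -> nat).
Hypothesis fl : forall x, scalar (f x).
Hypothesis f_diag : forall x, X x -> f x x != 0.
Hypothesis f_tri : forall x y, X x -> X y -> x != y -> (rk y <= rk x)%N -> f x y = 0.

(** Descending induction on the rank: once the coefficients of higher rank are
    known to vanish, [f x] only sees the coefficient of [x]. *)
Lemma triangular_coef0 (s : seq V) (c : V -> K) : uniq s ->
    (forall x, x \in s -> X x) ->
    (forall x, x \in s -> f x (\sum_(y <- s) c y *: y) = 0) ->
  forall x, x \in s -> c x = 0.
Proof.
move=> su sX f0.
have fE x : f x (\sum_(y <- s) c y *: y) = \sum_(y <- s) c y * f x y.
  rewrite (linear_fun_sum (W := K^o) (fl x)); apply: eq_bigr => y _.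
  exact: (linear_funZ (W := K^o) (fl x)).
have main n : forall x, x \in s -> (\max_(y <- s) rk y < rk x + n)%N -> c x = 0.
  elim: n => [|n IH] x xs lt_n.
    have := leq_bigmax_seq (P := xpredT) (F := rk) x xs isT.
    by rewrite leqNgt -[rk x]addn0 lt_n.
  have := f0 x xs; rewrite fE (bigD1_seq x) //= big_seq_cond big1 ?addr0.
    by move=> /eqP; rewrite mulf_eq0 (negPf (f_diag (sX x xs))) orbF => /eqP.
  move=> y /andP [ys yx]; have [le_yx|lt_xy] := leqP (rk y) (rk x).
    by rewrite f_tri ?mulr0 //; [exact: sX|exact: sX|rewrite eq_sym].
  rewrite IH ?mul0r //; apply: leq_trans lt_n _.
  by rewrite addnS -addSn leq_add2r.
move=> x xs; apply: (main (\max_(y <- s) rk y).+1) => //.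
by rewrite addnS ltnS leq_addl.
Qed.

Lemma triangular_indep : lin_indep X.
Proof.
move=> s c su sX s0; apply: (triangular_coef0 su sX) => x xs.
by rewrite s0; apply: (linear_fun0 (W := K^o) (fl x)).
Qed.

(** The argument for independence also shows that the functionals separate the
    span of [X]; this supplies functionals where no dual basis is at hand. *)
Lemma triangular_separates x : span X x -> x != 0 -> exists2 y, X y & f y x != 0.
Proof.
move=> /span_expand [s [c [su sX ->]]] nz; apply: contrapT => none.
have c0 : forall x, x \in s -> c x = 0.
  apply: (triangular_coef0 su sX) => y ys; apply/eqP/negPn/negP => fy.
  by apply: none; exists y => //; apply: sX.
by case/negP: nz; rewrite big_seq big1 // => y /c0 ->; rewrite scale0r.
Qed.

End Triangular.

Section Subalgebras.
Variable A : algType K.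
Implicit Types S X : set A.

Lemma subalg_gen_subalg X : is_subalgebra (subalg_gen X).
Proof.
split=> [||x y Xx Xy S SS XS]; last 1 first.
- by have [_ _] := SS; apply; [apply: Xx|apply: Xy].
- split=> [S [[]]//|a u v Xu Xv S SS XS].
  by have [[_ +] _ _] := SS; apply; [apply: Xu|apply: Xv].
- by move=> S [].
Qed.

Lemma sub_subalg_gen X : X `<=` subalg_gen X.
Proof. by move=> x Xx S _; apply. Qed.

Lemma subalg_gen_sub X S : is_subalgebra S -> X `<=` S -> subalg_gen X `<=` S.
Proof. by move=> SS XS x; apply. Qed.

Lemma subalgX S x n : is_subalgebra S -> S x -> S (x ^+ n).
Proof.
move=> [_ S1 SM] Sx; elim: n => [|n IH]; first by rewrite expr0.
by rewrite exprS; apply: SM.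
Qed.

Lemma preim_subalg (B : algType K) (f : A -> B) (S : set B) :
  linear f -> monoid_morphism f -> is_subalgebra S -> is_subalgebra [set x | S (f x)].
Proof.
move=> fl [f1 fM] [SS S1 SM]; split=> [||x y Sx Sy] /=; rewrite ?f1 ?fM //.
  exact: preim_subspace.
exact: SM.
Qed.

(** To show that a subalgebra lies in a subspace containing 1, it is thus enough
    to check that its generators stabilise the subspace. *)
Lemma stabiliser_subalg (L : set A) : is_subspace L ->
  is_subalgebra [set x | forall l, L l -> L (x * l)].
Proof.
move=> LS; split=> [||x y Lx Ly l Ll] /=; first 1 last.
- by move=> l; rewrite mul1r.
- by rewrite -mulrA; apply/Lx/Ly.
split=> [l _|a x y Lx Ly l Ll] /=; first by rewrite mul0r; apply: LS.1.
by rewrite mulrDl -scalerAl; apply: LS.2; [apply: Lx|apply: Ly].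
Qed.

End Subalgebras.

End Subspaces.

Lemma mulr_bracket (R : pzRingType) (t x d : R) :
  t * x * d - t * d * x = t * (x * d - d * x).
Proof. by rewrite mulrBr !mulrA. Qed.

Lemma linear_mull (K : fieldType) (A : algType K) (x : A) a y z :
  x * (a *: y + z) = a *: (x * y) + x * z.
Proof. by rewrite mulrDr scalerAr. Qed.

Lemma linear_mulr (K : fieldType) (A : algType K) (x : A) a y z :
  (a *: y + z) * x = a *: (y * x) + z * x.
Proof. by rewrite mulrDl scalerAl. Qed.

(** Pascal's rule, in the form used to pass from one power of a derivation to the
    next. *)
Lemma pascal_sum (V : nmodType) (n : nat) (F : nat -> nat -> V) :
  \sum_(k < n.+2) F k (n.+1 - k)%N *+ 'C(n.+1, k) =
  \sum_(k < n.+1) (F k (n - k).+1 + F k.+1 (n - k)%N) *+ 'C(n, k).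
Proof.
transitivity (\sum_(k < n.+1) F k (n - k).+1 *+ 'C(n, k) +
              \sum_(k < n.+1) F k.+1 (n - k)%N *+ 'C(n, k)); last first.
  by rewrite -big_split /=; apply: eq_bigr => k _; rewrite mulrnDl.
rewrite big_ord_recl /= bin0 subn0.
under eq_bigr => k _ do rewrite /bump /= add1n binS mulrnDr subSS.
rewrite big_split /= addrA; congr (_ + _).
rewrite big_ord_recr /= bin_small // mulr0n addr0.
rewrite [RHS]big_ord_recl /= bin0 subn0; congr (_ + _).
by apply: eq_bigr => k _; rewrite /bump /= add1n -subSn ?subSS.
Qed.

(** * Two generators and their iterated commutators *)

Section TwoGenerators.
Variables (K : fieldType) (A : algType K) (g h : A).

Definition adr (x : A) : A := x * h - h * x.
Definition ad_iter (k : nat) : A := iter k adr g.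
Definition gh_pow (n : nat) : A := g * h ^+ n.
Local Notation e := ad_iter.
Local Notation w := gh_pow.

Definition ad_mon (s : seq (nat * nat)) : A := \prod_(p <- s) e p.1 ^+ p.2.
(** The exponent of each generator in [ad_mon s]: an index may be repeated in [s]. *)
Definition expo (s : seq (nat * nat)) (k : nat) : nat :=
  (\sum_(p <- s | p.1 == k) p.2)%N.

Lemma w0 : w 0 = g.
Proof. by rewrite /w expr0 mulr1. Qed.

Lemma wSr n : w n.+1 = w n * h.
Proof. by rewrite /w exprSr mulrA. Qed.

Lemma eS k : e k.+1 = e k * h - h * e k.
Proof. by []. Qed.

Lemma e_mulh m : e m * h = h * e m + e m.+1.
Proof. by rewrite /= /adr addrC subrK. Qed.

(** Leibniz formula: h acts on the a_k as a derivation. *)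
Lemma e_mulhX m n :
  e m * h ^+ n = \sum_(k < n.+1) (h ^+ (n - k) * e (m + k)) *+ 'C(n, k).
Proof.
elim: n => [|n IH]; first by rewrite big_ord1 /= subn0 mul1r mulr1 addn0.
rewrite (pascal_sum n (fun k j => h ^+ j * e (m + k))) exprSr mulrA IH mulr_suml.
apply: eq_bigr => k _; rewrite mulrnAl -mulrA e_mulh mulrDr mulrA -exprSr.
by rewrite addnS.
Qed.

Lemma e_mulw m n :
  (forall i j, e i * e j = e j * e i) ->
  e m * w n = \sum_(k < n.+1) (w (n - k) * e (m + k)) *+ 'C(n, k).
Proof.
move=> eC; rewrite /w mulrA (eC m 0%N) -mulrA e_mulhX mulr_sumr.
by apply: eq_bigr => k _; rewrite mulrnAr mulrA.
Qed.

Lemma w_mulw m n :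
  w m * w n = \sum_(k < n.+1) (w (m + n - k) * e k) *+ 'C(n, k).
Proof.
rewrite {2}/w -[g in X in _ * X]/(e 0) e_mulhX mulr_sumr.
apply: eq_bigr => k _; rewrite mulrnAr mulrA; congr (_ * _ *+ _).
by rewrite /w -mulrA -exprD addnBA // -ltnS.
Qed.

(** Expansion of the n-fold bracket with h: left and right multiplication by h
    commute, so this is a binomial formula. *)
Lemma e_expand s :
  e s = \sum_(t < s.+1) ((-1) ^+ t * (h ^+ t * w (s - t))) *+ 'C(s, t).
Proof.
elim: s => [|s IH]; first by rewrite big_ord1 /= /w subn0 !mul1r mulr1.
rewrite (pascal_sum s (fun t j => (-1) ^+ t * (h ^+ t * w j))).
rewrite [LHS]/= -/(e s) /adr IH mulr_suml mulr_sumr -sumrB.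
apply: eq_bigr => t _; rewrite mulrnAl mulrnAr -mulrnBl; congr (_ *+ _).
congr (_ + _); first by rewrite /w exprSr !mulrA.
rewrite [h * _]mulrA; have -> : h * (-1) ^+ t = (-1) ^+ t * h.
  exact: commr_sign.
by rewrite [in RHS]exprS mulN1r !mulNr exprS !mulrA.
Qed.

Lemma w_mule r s :
  w r * e s = \sum_(t < s.+1) (-1) ^+ t * (w (r + t) * w (s - t)) *+ 'C(s, t).
Proof.
rewrite e_expand mulr_sumr; apply: eq_bigr => t _.
rewrite mulrnAr; congr (_ *+ _).
have -> : w r * ((-1) ^+ t * (h ^+ t * w (s - t))) =
          (-1) ^+ t * (w r * (h ^+ t * w (s - t))).
  by rewrite [LHS]mulrA [RHS]mulrA; congr (_ * _); exact: commr_sign.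
by rewrite mulrA {1 3}/w exprD !mulrA.
Qed.

Hypothesis eC : forall i j, e i * e j = e j * e i.

Lemma eXC i j m n : e i ^+ m * e j ^+ n = e j ^+ n * e i ^+ m.
Proof. by apply/commrX/commr_sym/commrX/eC. Qed.

Lemma e_prod_insert i n (l : seq nat) (f : nat -> nat) : uniq l -> i \in l ->
  e i ^+ n * \prod_(k <- l) e k ^+ f k =
  \prod_(k <- l) e k ^+ ((if i == k then n else 0) + f k).
Proof.
elim: l => // k l IH /= /andP [kl ul]; rewrite inE !big_cons.
have [-> _|_ /= il] := eqVneq i k; last by rewrite mulrA eXC -mulrA IH.
rewrite mulrA -exprD; congr (_ * _); rewrite !big_seq.
by apply: eq_bigr => j jl; case: eqP jl kl => // <- ->.
Qed.

(** Zero exponents are harmless, so a monomial can be written over all indices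
    below a bound, in decreasing order; two monomials become comparable this
    way. *)
Lemma emon_normal s N : (forall p, p \in s -> p.1 < N)%N ->
  ad_mon s = \prod_(k <- rev (iota 0 N)) e k ^+ expo s k.
Proof.
elim: s => [_|[i n] s IH sN].
  by rewrite /ad_mon big_nil big1 // => k _; rewrite /expo big_nil.
rewrite /ad_mon big_cons /= -/(ad_mon s) IH => [|p ps]; last first.
  by apply: sN; rewrite inE ps orbT.
rewrite e_prod_insert ?rev_uniq ?iota_uniq //; last first.
  by rewrite mem_rev mem_iota /= add0n (sN (i, n)) ?mem_head.
by apply: eq_bigr => k _; rewrite /expo big_cons /=; case: eqP.
Qed.

Lemma emon_expo s t : expo s =1 expo t -> ad_mon s = ad_mon t.
Proof.
move=> st; pose N := (\max_(p <- s ++ t) p.1).+1.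
have lt_N p : p \in s ++ t -> (p.1 < N)%N.
  by move=> pst; rewrite ltnS (leq_bigmax_seq (P := xpredT) (F := fst) p).
rewrite (@emon_normal s N) ?(@emon_normal t N); last 2 first.
- by move=> p pt; apply: lt_N; rewrite mem_cat pt orbT.
- by move=> p ps; apply: lt_N; rewrite mem_cat ps.
by apply: eq_bigr => k _; rewrite st.
Qed.

Lemma emon_decreasing s : exists2 t, decreasing_exps t & ad_mon s = ad_mon t.
Proof.
pose N := (\max_(p <- s) p.1).+1.
exists [seq (k, expo s k) | k <- rev (iota 0 N)].
  rewrite /decreasing_exps size_map size_rev size_iota /=.
  by rewrite sorted_map rev_sorted; apply: sub_sorted (iota_ltn_sorted 0 N).
rewrite (@emon_normal s N) /ad_mon ?big_map // => p ps.
by rewrite ltnS (leq_bigmax_seq (P := xpredT) (F := fst) p).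
Qed.

Definition ad_mons : set A := [set x | exists2 s, decreasing_exps s & x = ad_mon s].
Definition gh_mons : set A :=
  [set x | exists m s, decreasing_exps s /\ x = w m * ad_mon s].

Lemma emons_emon s : ad_mons (ad_mon s).
Proof. by have [t dt ->] := emon_decreasing s; exists t. Qed.

Lemma wemons_emon m s : gh_mons (w m * ad_mon s).
Proof. by have [t dt ->] := emon_decreasing s; exists m, t. Qed.

Lemma w_wemons m : gh_mons (w m).
Proof. by have := wemons_emon m [::]; rewrite /ad_mon big_nil mulr1. Qed.

Lemma e_emons k x : ad_mons x -> ad_mons (e k * x).
Proof.
move=> [s _ ->]; have := emons_emon ((k, 1%N) :: s).
by rewrite /ad_mon big_cons /=.
Qed.

Lemma w_e_wemons m k x : ad_mons x -> gh_mons (w m * (e k * x)).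
Proof. by move=> /(e_emons k) [s ds ->]; exists m, s. Qed.

Lemma mull_linear (a : A) : linear ( *%R a).
Proof. by move=> c x y; apply: linear_mull. Qed.

Lemma mulr_linear (a : A) : linear ( *%R^~ a).
Proof. by move=> c x y; apply: linear_mulr. Qed.

Lemma e_wemons k x : span gh_mons x -> span gh_mons (e k * x).
Proof.
apply: (span_image (mull_linear _)) => _ [m [s [ds ->]]].
rewrite mulrA e_mulw // mulr_suml; apply: (subspace_sum (span_subspace _)) => i _.
rewrite mulrnAl -mulrA; apply: (subspaceMn (span_subspace _)).
by apply: sub_span; apply: w_e_wemons; apply: emons_emon.
Qed.

Lemma w_span_wemons k x : span gh_mons x -> span gh_mons (w k * x).
Proof.
apply: (span_image (mull_linear _)) => _ [m [s [ds ->]]].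
rewrite mulrA w_mulw mulr_suml; apply: (subspace_sum (span_subspace _)) => i _.
rewrite mulrnAl -mulrA; apply: (subspaceMn (span_subspace _)).
by apply: sub_span; apply: w_e_wemons; apply: emons_emon.
Qed.

(** The two algebras of the statement, for arbitrary g and h: the image of the
    Faa di Bruno bialgebra, and its extension by the iterated commutators. *)
Definition fdb_alg : set A := subalg_gen [set x | exists n, x = w n].
Definition fdb_ext : set A := subalg_gen [set x | exists n, x = w n \/ x = e n].

Lemma w_fdb_alg n : fdb_alg (w n).
Proof. by apply: sub_subalg_gen; exists n. Qed.

Lemma fdb_alg_ext : fdb_alg `<=` fdb_ext.
Proof.
apply: (subalg_gen_sub (subalg_gen_subalg _)) => _ [n ->].
by apply: sub_subalg_gen; exists n; left.
Qed.

Lemma w_fdb_ext n : fdb_ext (w n).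
Proof. by apply: sub_subalg_gen; exists n; left. Qed.

Lemma e_fdb_ext n : fdb_ext (e n).
Proof. by apply: sub_subalg_gen; exists n; right. Qed.

Lemma emon_fdb_ext s : fdb_ext (ad_mon s).
Proof.
have BS := subalg_gen_subalg [set x | exists n, x = w n \/ x = e n].
have [_ B1 BM] := BS; rewrite /ad_mon; elim/big_rec: _ => [//|p x _ Bx].
by apply: BM => //; apply: (subalgX _ BS); apply: e_fdb_ext.
Qed.

Definition ext_basis : set A := ad_mons `|` gh_mons.

(** The span of the monomials contains 1 and is stable under left multiplication
    by the generators. *)
Lemma ext_basis_span : span ext_basis = fdb_ext.
Proof.
apply/seteqP; split=> [|x Bx].
  have [BS _ BM] := subalg_gen_subalg [set x | exists n, x = w n \/ x = e n].
  apply: (span_sub BS) => _ [[s _ ->]|[m [s [_ ->]]]]; first exact: emon_fdb_ext.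
  by apply: BM; [apply: w_fdb_ext|apply: emon_fdb_ext].
have LS := span_subspace ext_basis.
have spW : span gh_mons `<=` span ext_basis by apply: spanS; apply: subsetUr.
have -> : x = x * ad_mon [::] by rewrite /ad_mon big_nil mulr1.
suff: [set x | forall l, span ext_basis l -> span ext_basis (x * l)] x.
  by apply; apply: sub_span; left; apply: emons_emon.
apply: subalg_gen_sub x Bx; first exact: stabiliser_subalg.
move=> _ [n [->|->]] /=; apply: (span_image (mull_linear _)) => x [].
- by move=> [s ds ->]; apply: sub_span; right; exists n, s.
- by move=> /sub_span /(w_span_wemons n) /spW.
- by move=> /(e_emons n) en; apply: sub_span; left.
- by move=> /sub_span /(e_wemons n) /spW.
Qed.

(** A monomial g h^m a^mu lies in the smaller algebra although the a_k do not:
    the left ideal generated by the g h^r is stable under right multiplication by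
    the a_k, since (g h^r) a_s is a combination of products of two factors g h^i. *)
Lemma fdb_basis_span : span ([set 1] `|` gh_mons) = fdb_alg.
Proof.
have [SS S1 SM] := subalg_gen_subalg [set x | exists n, x = w n].
apply/seteqP; split=> [|x Sx]; last first.
  have LS := span_subspace ([set 1] `|` gh_mons).
  have spW : span gh_mons `<=` span ([set 1] `|` gh_mons).
    by apply: spanS; apply: subsetUr.
  rewrite -[x]mulr1; set L := span _ in LS spW *.
  suff: [set x | forall l, L l -> L (x * l)] x by apply; apply: sub_span; left.
  apply: subalg_gen_sub x Sx; first exact: stabiliser_subalg.
  move=> _ [n ->] /=; apply: (span_image (mull_linear _)) => y [->|].
    by rewrite mulr1; apply: sub_span; right; apply: w_wemons.
  by move=> /sub_span /(w_span_wemons n) /spW.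
apply: (span_sub SS) => _ [->//|[m [s [_ ->]]]].
pose N : set A := span [set x | exists2 a, fdb_alg a & exists r, x = a * w r].
have Ne k x : N x -> N (x * e k).
  apply: (span_image (mulr_linear _)) => _ [a Sa [r ->]].
  rewrite -mulrA w_mule mulr_sumr.
  apply: (subspace_sum (span_subspace _)) => t _.
  rewrite mulrnAr; apply: (subspaceMn (span_subspace _)).
  have -> : a * ((-1) ^+ t * (w (r + t) * w (k - t))) =
            (-1) ^+ t *: (a * w (r + t) * w (k - t)).
    rewrite -(signr_odd A) -(signr_odd K) mulr_sign scaler_sign.
    by case: odd; rewrite ?mulrN mulrA.
  apply: (subspaceZ (span_subspace _)); apply: sub_span.
  by exists (a * w (r + t)); [apply: SM => //; apply: w_fdb_alg|exists (k - t)%N].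
have NeX k n x : N x -> N (x * e k ^+ n).
  elim: n x => [|n IH] x Nx; first by rewrite expr0 mulr1.
  by rewrite exprS mulrA; apply: IH; apply: Ne.
have: N (w m * ad_mon s).
  have: N (w m) by apply: sub_span; exists 1 => //; exists m; rewrite mul1r.
  rewrite /ad_mon; elim: s (w m) => [|p s IH] x Nx; first by rewrite big_nil mulr1.
  by rewrite big_cons mulrA; apply: IH; apply: NeX.
apply: span_sub (w m * ad_mon s) => // _ [a Sa [r ->]].
by apply: SM => //; apply: w_fdb_alg.
Qed.

End TwoGenerators.

(** * Lyndon words with at most two letters g *)

Section Words.
Implicit Type v : seq bool.

Lemma lyndonP v : reflect
  (v <> [::] /\ forall i, (0 < i < size v)%N -> ((v : seqlexi bool) < rot i v)%O)
  (lyndon v).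
Proof.
have mem_i i : (i \in iota 1 (size v).-1) = (0 < i < size v)%N.
  by rewrite mem_iota; case: i => // i; case: size => //; rewrite add1n.
apply: (iffP andP) => -[]; first move=> /eqP v0 /allP lt_v.
  by split=> // i iv; apply: lt_v; rewrite mem_i.
move=> /eqP v0 lt_v; split=> //; apply/allP => i.
by rewrite mem_i; apply: lt_v.
Qed.

Lemma nseq_h v : count_mem letter_g v = 0%N -> v = nseq (size v) letter_h.
Proof. by elim: v => //= -[] v IH //= /IH {1}->. Qed.

Lemma lyndon_g0 v : lyndon v -> count_mem letter_g v = 0%N -> v = [:: letter_h].
Proof.
move=> /lyndonP [v0 lt_v] /nseq_h; case: (size v) lt_v => [|[|n]] lt_v ve.
- by case: v0.
- by [].
have := lt_v 1%N isT; rewrite ve /= rot1_cons.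
by rewrite -[RHS in (_ < RHS)%O](@cats1 _ (_ :: _)) -(nseqD n.+1 1) addn1 ltxx.
Qed.

(** Otherwise, the rotation that starts at the first g would be smaller. *)
Lemma lyndon_head v : lyndon v -> (0 < count_mem letter_g v)%N ->
  exists v', v = letter_g :: v'.
Proof.
case: v => [|[] v] // /lyndonP [_ lt_v] g_v; last by exists v.
set u := letter_h :: v; have gu : letter_g \in u by rewrite -has_pred1 has_count.
have iu : (0 < index letter_g u < size u)%N by rewrite index_mem gu.
by have := lt_v _ iu; rewrite /rot (drop_nth letter_g) ?index_mem // nth_index.
Qed.

Lemma lyndon_g1 v : lyndon v -> count_mem letter_g v = 1%N ->
  v = omega (size v).-1.
Proof.
move=> lv v1; have [|v' ve] := lyndon_head lv; first by rewrite v1.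
by move: v1; rewrite ve /omega /= => -[] /nseq_h <-.
Qed.

(** With a first letter g, it is enough to compare with the rotations that cut
    the tail. *)
Lemma lyndon_g_cons v :
  (forall i, (i < size v)%N ->
     ((letter_g :: v : seqlexi bool) < drop i v ++ letter_g :: take i v)%O) ->
  lyndon (letter_g :: v).
Proof.
by move=> lt_v; apply/lyndonP; split=> // -[|i] // iv; apply: lt_v.
Qed.

Lemma lyndon_omega k : lyndon (omega k).
Proof.
apply: lyndon_g_cons => i; rewrite size_nseq => ik.
by rewrite (drop_nth letter_g) ?size_nseq // nth_nseq ik ltxi_cons.
Qed.

Lemma ltxi_nseq_h m n v v' : (m < n)%N ->
  ((nseq m letter_h ++ letter_g :: v : seqlexi bool) < nseq n letter_h ++ v')%O.
Proof.
elim: m n => [|m IH] [|n] // mn.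
by rewrite /= ltxi_cons lexx /=; apply: IH.
Qed.

(** All rotations but one start with the letter h; the remaining one is
    omega_n omega_m, which is larger because its first block of h is longer. *)
Lemma lyndon_omega_cat m n : (m < n)%N -> lyndon (omega m ++ omega n).
Proof.
move=> mn; apply: lyndon_g_cons => i.
rewrite size_cat size_nseq /= size_nseq => ik.
have nthE : nth letter_g (nseq m letter_h ++ omega n) i = (i != m).
  rewrite nth_cat size_nseq; case: ltngtP => [im|mi|->].
  - by rewrite nth_nseq im.
  - rewrite -[(i - m)%N]prednK ?subn_gt0 //= nth_nseq.
    by rewrite prednK ?subn_gt0 // leq_subLR -ltnS -addnS ik.
  - by rewrite subnn.
have [im|im] := eqVneq i m; last first.
  by rewrite (drop_nth letter_g) ?size_cat ?size_nseq /= ?size_nseq // nthE im ltxi_cons.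
rewrite {}im drop_size_cat ?size_nseq // take_size_cat ?size_nseq //=.
by rewrite ltxi_cons lexx /=; apply: ltxi_nseq_h.
Qed.

Lemma std_indexE v i : (i < size v)%N ->
  lyndon (take i v) -> lyndon (drop i v) ->
  (forall j, (0 < j < i)%N -> ~~ lyndon (drop j v)) -> std_index v = i.
Proof.
move=> iv lt_i ld_i nl; rewrite /std_index.
set a := fun i => _; have ai : a i by rewrite /a lt_i.
have na j : (j < i)%N -> a j = false.
  rewrite /a; case: j => [|j] ji; first by rewrite take0.
  by rewrite (negPf (nl _ _)) ?andbF.
rewrite -(subnKC (ltnW iv)) iotaD find_cat size_iota.
have -> : has a (iota 0 i) = false.
  by apply/negP => /hasP [j]; rewrite mem_iota add0n /= => /na ->.
by rewrite -[(size v - i)%N]prednK ?subn_gt0 //= add0n ai addn0.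
Qed.

Lemma not_lyndon_h v : v != [::] -> ~~ lyndon (letter_h :: v).
Proof.
move=> v0; apply/negP => lv.
have [g0|] := posnP (count_mem letter_g (letter_h :: v)).
  by have [/eqP] := lyndon_g0 lv g0; rewrite (negPf v0).
by move=> /(lyndon_head lv) [].
Qed.

Lemma omega_rcons k : omega k.+1 = omega k ++ [:: letter_h].
Proof. by rewrite /omega -addn1 nseqD. Qed.

Lemma std_index_omega k : std_index (omega k.+1) = k.+1.
Proof.
apply: std_indexE => [||| [|j] // /andP [_ jk]]; first by rewrite /= size_nseq.
- by rewrite omega_rcons take_size_cat ?lyndon_omega //= size_nseq.
- by rewrite omega_rcons drop_size_cat //= size_nseq.
have -> : drop j.+1 (omega k.+1) = nseq (k.+1 - j) letter_h.
  exact: (drop_nseq j k.+1).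
have jk' : (0 < k - j)%N by rewrite subn_gt0.
by rewrite subSn ?not_lyndon_h // -?size_eq0 ?size_nseq -?lt0n // ltnW.
Qed.

Lemma std_index_omega_cat m n : (m < n)%N -> std_index (omega m ++ omega n) = m.+1.
Proof.
move=> mn; apply: std_indexE => [||| [|j] // /andP [_ jm]].
- by rewrite size_cat /= !size_nseq -addSnnS leq_addr.
- by rewrite take_size_cat ?lyndon_omega //= size_nseq.
- by rewrite drop_size_cat ?lyndon_omega //= size_nseq.
rewrite /= drop_cat size_nseq; rewrite ltnS in jm; rewrite jm drop_nseq.
by rewrite -[(m - j)%N]prednK ?subn_gt0 // not_lyndon_h // -size_eq0 size_cat addnS.
Qed.

End Words.

(** * The free algebra, its right actions and the quotient *)

(** An element of a monoid algebra is a linear combination of monomials. *)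
Lemma malg_ind (K : fieldType) (I : choiceType) (P : {malg K[I]} -> Prop) :
  (forall a x y, P x -> P y -> P (a *: x + y)) -> P 0 ->
  (forall i, P << i >>) -> forall x, P x.
Proof.
move=> PD P0 PU x; rewrite [x]monalgE; elim/big_rec: _ => // i y _ Py.
have -> : << x@_i *g i >> = x@_i *: << i >>.
  by apply/malgP => k; rewrite mcoeffZ !mcoeffU mulr_natr.
exact: PD.
Qed.

Section FreeAlgebra.
Variable K : fieldType.
Local Notation T := (free_alg K).
Local Notation gT := (gT K).
Local Notation hT := (hT K).

Lemma wordM u v : word K (u ++ v) = word K u * word K v.
Proof.
rewrite /word [RHS]malgM_def fgmulUU mulr1; congr << _ >>.
by apply/eqP; rewrite fmP fmM.
Qed.

Lemma word_nil : word K [::] = 1.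
Proof. by congr << _ >>; apply/eqP; rewrite fmP fm1. Qed.

Lemma word_omega n : word K (omega n) = gT * hT ^+ n.
Proof.
rewrite (wordM [:: letter_g]); congr (_ * _); elim: n => [|n IH].
  by rewrite word_nil.
by rewrite exprS -IH -wordM.
Qed.

Lemma Elyn_rec_omega n k : (k < n)%N -> Elyn_rec K n (omega k) = ad_iter gT hT k.
Proof.
elim: n k => [k|n IH [_|k]]; [by rewrite ltn0|by []|]; rewrite ltnS => kn.
rewrite Elyn_recE; last by rewrite /= size_nseq.
rewrite std_index_omega omega_rcons take_size_cat; last by rewrite /= size_nseq.
rewrite drop_size_cat; last by rewrite /= size_nseq.
rewrite (IH _ kn); case: n kn {IH} => [|n] _; by [].
Qed.

Lemma Elyn_omega k : Elyn K (omega k) = ad_iter gT hT k.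
Proof. by rewrite /Elyn Elyn_rec_omega //= size_nseq. Qed.

Lemma Elyn_omega_cat m n : (m < n)%N ->
  Elyn K (omega m ++ omega n) = commutator (ad_iter gT hT m) (ad_iter gT hT n).
Proof.
move=> mn; have sz : size (omega m ++ omega n) = (m + n).+2.
  by rewrite size_cat /= !size_nseq addnS.
rewrite /Elyn sz Elyn_recE; last by rewrite sz.
rewrite (std_index_omega_cat mn) take_size_cat; last by rewrite /= size_nseq.
rewrite drop_size_cat; last by rewrite /= size_nseq.
by rewrite !Elyn_rec_omega ?ltnS ?leq_addr ?leq_addl.
Qed.

Lemma ideal_commutator (A : algType K) (J : set A) x y : is_ideal J ->
  J x \/ J y -> J (commutator x y).
Proof.
by move=> [JS JM] []; [move=> /JM - /(_ y) []|move=> /JM - /(_ x) []] => ? ?;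
  apply: subspaceB.
Qed.

(** Induction on the length of a Lyndon word, along its standard factorization.
    If no factor has two letters g then both have exactly one, and are therefore
    of the form omega_i. *)
Lemma idealT_sub (J : set T) : is_ideal J ->
  (forall i j, J (commutator (ad_iter gT hT i) (ad_iter gT hT j))) -> @idealT K `<=` J.
Proof.
move=> JI Je x; apply=> // {x} _ [v [lv v2 ->]].
suff main n u : lyndon u -> (1 < count_mem letter_g u)%N -> (size u <= n)%N ->
    J (Elyn_rec K n u) by apply: main.
elim: n u => [|n IH] u lu u2 un.
  by move: un u2; rewrite leqn0 => /nilP ->.
rewrite Elyn_recE; last exact: leq_trans u2 (count_size _ _).
have [|nofact] :=
  boolP (has (fun i => lyndon (take i u) && lyndon (drop i u)) (iota 0 (size u))).
  move=> fact; have := nth_find 0%N fact; move: fact; rewrite has_find size_iota.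
  rewrite -/(std_index u) => iu; rewrite nth_iota // add0n.
  set i := std_index u in iu * => /andP [lt ld].
  have i0 : (0 < i)%N by move: lt; case: (i) => [|//]; rewrite take0.
  have tn : (size (take i u) <= n)%N by rewrite size_take iu -ltnS (leq_trans iu).
  have dn : (size (drop i u) <= n)%N.
    by rewrite size_drop leq_subLR (leq_trans un) // -add1n leq_add2r.
  have [ct|ct] := ltnP 1 (count_mem letter_g (take i u)).
    by apply: ideal_commutator => //; left; apply: IH.
  have [cd|cd] := ltnP 1 (count_mem letter_g (drop i u)).
    by apply: ideal_commutator => //; right; apply: IH.
  have ctd : (count_mem letter_g (take i u) + count_mem letter_g (drop i u) > 1)%N.
    by rewrite -count_cat cat_take_drop.
  have ct1 : count_mem letter_g (take i u) = 1%N.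
    apply/eqP; rewrite eqn_leq ct; case: count ctd => //.
    by rewrite add0n ltnNge cd.
  have cd1 : count_mem letter_g (drop i u) = 1%N.
    apply/eqP; rewrite eqn_leq cd; case: (count _ (drop i u)) ctd => //.
    by rewrite addn0 ltnNge ct.
  have pred_lt x : lyndon x -> (size x <= n)%N -> ((size x).-1 < n)%N.
    by case: x.
  rewrite (lyndon_g1 lt ct1) (lyndon_g1 ld cd1).
  by rewrite (Elyn_rec_omega (pred_lt _ lt tn)) (Elyn_rec_omega (pred_lt _ ld dn)).
(* Without a standard factorization the index is the length of the word, and the
   recursion takes a commutator with the empty word. *)
rewrite /std_index hasNfind // size_iota take_size drop_size.
have -> : Elyn_rec K n [::] = 1 by rewrite -word_nil; case: (n).
by rewrite /commutator mulr1 mul1r subrr; apply: JI.1.1.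
Qed.

Lemma free_alg_ind (P : T -> Prop) :
  (forall a x y, P x -> P y -> P (a *: x + y)) -> (forall v, P (word K v)) ->
  forall x, P x.
Proof.
move=> PD Pw; apply: malg_ind => // [|v]; last by rewrite -(fmK v); apply: Pw.
by have := PD (-1) _ _ (Pw [::]) (Pw [::]); rewrite scaleN1r addNr.
Qed.

(** A right action of the free algebra is given by an operator for each letter.
    This form of the universal property covers algebra morphisms (operators of
    right multiplication) as well as modules, over any vector space. *)
Section Action.
Variables (M : lmodType K) (r : bool -> M -> M).
Hypothesis r_linear : forall l, linear (r l).

Definition word_act (m : M) (v : seq bool) : M := foldl (fun m l => r l m) m v.

Definition act (m : M) (x : T) : M :=
  \sum_(v <- msupp x) x@_v *: word_act m v.

Lemma act_linear m : linear (act m).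
Proof.
have actEw (d : {fset {fmonom bool}}) x : (msupp x `<=` d)%fset ->
    act m x = \sum_(v <- d) x@_v *: word_act m v.
  move=> le; rewrite /act (big_fset_incl _ le) //= => v _ /mcoeff_outdom ->.
  by rewrite scale0r.
move=> a x y; set d := (msupp x `|` msupp y)%fset.
rewrite !(@actEw d) ?fsubsetUl ?fsubsetUr //; last first.
  by apply: fsubset_trans (msuppD_le _ _) _; apply: fsetSU; apply: msuppZ_le.
rewrite scaler_sumr -big_split /=; apply: eq_bigr => p _.
by rewrite mcoeffD mcoeffZ scalerDl scalerA.
Qed.

Lemma actB m (x y : (T : algType K)) : act m (x - y) = act m x - act m y.
Proof. exact: linear_funB (act_linear m) x y. Qed.

Lemma act_word m v : act m (word K v) = word_act m v.
Proof. by rewrite /act /word msuppU1 big_seq_fset1 mcoeffUU scale1r. Qed.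

Lemma word_act_linear v : linear (word_act^~ v).
Proof. by elim: v => //= l v IH a m m'; rewrite r_linear IH. Qed.

Lemma act_linearl x : linear (act^~ x).
Proof.
move=> a m m'; rewrite /act scaler_sumr -big_split /=; apply: eq_bigr => v _.
rewrite (word_act_linear v) scalerDr; congr (_ + _).
by rewrite !scalerA mulrC.
Qed.

Lemma act1 m : act m 1 = m.
Proof. by rewrite -word_nil act_word. Qed.

Lemma actM m x y : act m (x * y) = act (act m x) y.
Proof.
elim/free_alg_ind: x => [a x x' IH IH'|u].
  rewrite (linear_mulr y a x x') (act_linear m a (x * y)) (act_linear m a x).
  by rewrite act_linearl; congr (_ *: _ + _).
elim/free_alg_ind: y => [a y y' IH IH'|v].
  rewrite (linear_mull _ a y y') (act_linear m a (_ * y)).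
  by rewrite (act_linear (act m _) a y); congr (_ *: _ + _).
by rewrite -wordM !act_word /word_act foldl_cat.
Qed.

Lemma act_g m : act m gT = r letter_g m. Proof. exact: act_word. Qed.
Lemma act_h m : act m hT = r letter_h m. Proof. exact: act_word. Qed.

(** The operator of the iterated commutator.  For right actions the bracket of
    operators is taken in the reverse order. *)
Fixpoint e_act (k : nat) (m : M) : M :=
  if k is k'.+1 then r letter_h (e_act k' m) - e_act k' (r letter_h m)
  else r letter_g m.

Lemma act_e k m : act m (ad_iter gT hT k) = e_act k m.
Proof.
elim: k m => [|k IH] m; first exact: act_g.
rewrite (eS gT hT k) actB [RHS]/=; congr (_ - _).
  by rewrite actM act_h IH.
by rewrite actM act_h IH.
Qed.

Hypothesis e_actC : forall i j m, e_act i (e_act j m) = e_act j (e_act i m).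

Lemma act_idealT m x : @idealT K x -> act m x = 0.
Proof.
move=> /idealT_sub - /(_ [set x | forall m, act m x = 0]); apply=> [|i j m'] /=.
  split=> [|a y y0].
    split=> [m'|a y z y0 z0 m'] /=; first exact: linear_fun0 (act_linear m').
    by rewrite act_linear y0 z0 scaler0 addr0.
  split=> m' /=; rewrite actM ?y0 //.
  exact: linear_fun0 (act_linearl a).
have actEE k l : act m' (ad_iter gT hT k * ad_iter gT hT l) = e_act l (e_act k m').
  by rewrite actM act_e act_e.
transitivity (e_act j (e_act i m') - e_act i (e_act j m')).
  exact: etrans (actB _ _ _) (congr2 (fun x y => x - y) (actEE i j) (actEE j i)).
by rewrite e_actC subrr.
Qed.

End Action.

Local Notation Tb := (Tbar K).
Local Notation pr := (@proj K).

Lemma proj_linear : linear pr.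
Proof. exact: linearP. Qed.

Lemma projB (x y : (T : algType K)) : pr (x - y) = pr x - pr y.
Proof. exact: linear_funB proj_linear x y. Qed.

Lemma projM x y : pr (x * y) = pr x * pr y.
Proof. exact: rmorphM. Qed.

Lemma proj1 : pr 1 = 1.
Proof. exact: rmorph1. Qed.

Lemma proj_eq x y : pr x = pr y <-> @idealT K (x - y).
Proof. exact: api_eq. Qed.

Lemma projK : cancel (@rep K) pr.
Proof. exact: arepK. Qed.

Definition gbar : Tb := pr gT.
Definition hbar : Tb := pr hT.

Lemma omegatE n : omegat K n = gh_pow gbar hbar n.
Proof. by rewrite /omegat word_omega projM rmorphXn. Qed.

Lemma proj_e k : pr (ad_iter gT hT k) = ad_iter gbar hbar k.
Proof.
elim: k => [|k IH]; first by [].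
have IHl : pr (ad_iter gT hT k * hT) = ad_iter gbar hbar k * hbar by rewrite projM IH.
have IHr : pr (hT * ad_iter gT hT k) = hbar * ad_iter gbar hbar k.
  by rewrite projM; congr (_ * _).
exact: etrans (projB _ _) (congr2 (fun x y => x - y) IHl IHr).
Qed.

Lemma EomegaE n : Eomega K n = ad_iter gbar hbar n.
Proof. by rewrite /Eomega Elyn_omega proj_e. Qed.

(** For i < j, the commutator of a_i and a_j is E_alpha for the Lyndon word
    alpha = omega_i omega_j. *)
Lemma Tbar_eC i j :
  ad_iter gbar hbar i * ad_iter gbar hbar j = ad_iter gbar hbar j * ad_iter gbar hbar i.
Proof.
have main m n : (m < n)%N ->
    ad_iter gbar hbar m * ad_iter gbar hbar n = ad_iter gbar hbar n * ad_iter gbar hbar m.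
  move=> mn; rewrite -!proj_e -!projM; apply/proj_eq => J JI; apply.
  exists (omega m ++ omega n); split; last by rewrite Elyn_omega_cat.
    exact: lyndon_omega_cat.
  by rewrite count_cat /= addnACA.
by case: (ltngtP i j) => [ij|ji|->]; [exact: main|apply: esym; exact: main|].
Qed.

Lemma Tbar_ind (P : Tb -> Prop) :
  (forall a x y, P x -> P y -> P (a *: x + y)) -> P 1 ->
  (forall x, P x -> P (x * gbar)) -> (forall x, P x -> P (x * hbar)) ->
  forall x, P x.
Proof.
move=> PD P1 Pg Ph x; rewrite -[x]projK.
elim/free_alg_ind: (rep x) => [a y z|v]; first by rewrite proj_linear; apply: PD.
elim/last_ind: v => [|v l]; first by rewrite word_nil proj1.
by rewrite -cats1 wordM projM; case: l => [/Ph|/Pg].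
Qed.

(** Universal property of the quotient. *)
Lemma Tbar_act (M : lmodType K) (r : bool -> M -> M) (m : M) :
    (forall l, linear (r l)) ->
    (forall i j m, e_act r i (e_act r j m) = e_act r j (e_act r i m)) ->
  exists f : Tb -> M, [/\ linear f, f 1 = m,
    forall x, f (x * gbar) = r letter_g (f x),
    forall x, f (x * hbar) = r letter_h (f x)
    & forall x, f (pr x) = act r m x].
Proof.
move=> rl rC; have fE x : act r m (rep (pr x)) = act r m x.
  apply/eqP; rewrite -subr_eq0 -(linear_funB (act_linear r m)); apply/eqP.
  by apply: act_idealT => //; apply/proj_eq; rewrite projK.
have al := act_linear r m.
exists (fun x => act r m (rep x)); split=> [a x y||x|x|//].
- by rewrite -[x in LHS]projK -[y in LHS]projK -proj_linear fE al.
- by rewrite -proj1 fE act1.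
- by rewrite -[x in LHS]projK -projM fE actM // act_g.
- by rewrite -[x in LHS]projK -projM fE actM // act_h.
Qed.

End FreeAlgebra.

(** * Tensor products and bialgebras on two generators *)

Section TensorMaps.
Variable K : fieldType.

Lemma tensor_ext (U V W : lmodType K) (f f' : tensor U V -> W) :
  linear f -> linear f' -> (forall u v, f (u \ox v) = f' (u \ox v)) -> f =1 f'.
Proof.
move=> fl fl' ff' t; elim/tensor_ind: t => // a x y fx fy.
by rewrite fl fl' fx fy.
Qed.

Section Map.
Variables (U V U' V' : lmodType K) (f : U -> U') (f' : V -> V').
Hypotheses (fl : linear f) (fl' : linear f').

Let fbl v : linear (fun u => f u \ox f' v).
Proof. by move=> a x y; rewrite fl tens_linearl. Qed.

Let fbr u : linear (fun v => f u \ox f' v).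
Proof. by move=> a x y; rewrite fl' tens_linearr. Qed.

Lemma tmap_linear : linear (tmap f f').
Proof. exact: tlift_linear fbl fbr. Qed.

Lemma tmap_tens u v : tmap f f' (u \ox v) = f u \ox f' v.
Proof. exact: tlift_tens fbl fbr u v. Qed.

End Map.

Section Assoc.
Variables U V W : lmodType K.

Let assocl (z : W) (v : V) : linear (fun u : U => u \ox (v \ox z)).
Proof. exact: tens_linearl. Qed.

Let assocr (z : W) (u : U) : linear (fun v : V => u \ox (v \ox z)).
Proof. by move=> a x y; rewrite tens_linearl tens_linearr. Qed.

Let assoc_linearl (z : W) :
  linear (fun t : tensor U V => tlift (fun u v => u \ox (v \ox z)) t).
Proof. exact: tlift_linear (assocl z) (assocr z). Qed.

Let assoc_linearr (t : tensor U V) :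
  linear (fun z : W => tlift (fun u v => u \ox (v \ox z)) t).
Proof.
move=> a x y; elim/tensor_ind: t => [b s t Hs Ht|u v].
  by rewrite !assoc_linearl Hs Ht linear_swap.
rewrite !(tlift_tens (assocl _) (assocr _)).
by rewrite tens_linearr tens_linearr.
Qed.

Lemma tassoc_linear : linear (@tassoc K U V W).
Proof. exact: tlift_linear assoc_linearl assoc_linearr. Qed.

Lemma tassoc_tens u v z :
  tassoc ((u \ox v) \ox z) = u \ox (v \ox z) :> tensor U (tensor V W).
Proof.
rewrite /tassoc (tlift_tens assoc_linearl assoc_linearr).
exact: tlift_tens (assocl z) (assocr z) u v.
Qed.

End Assoc.

Section Slices.
Variables (U V : lmodType K).

(** Contraction of one tensor factor with a linear functional. *)
Definition lslice (f : U -> K) : tensor U V -> V := tlift (fun u v => f u *: v).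
Definition rslice (f : V -> K) : tensor U V -> U := tlift (fun u v => f v *: u).

Let scale_linearr (W : lmodType K) (a : K) : linear (fun v : W => a *: v).
Proof. by move=> b x y; rewrite scalerDr !scalerA mulrC. Qed.

Let scale_linearl (W W' : lmodType K) (f : W' -> K) (v : W) :
  scalar f -> linear (fun u => f u *: v).
Proof. by move=> fl b x y; rewrite fl scalerDl scalerA. Qed.

Lemma lslice_linear f : scalar f -> linear (lslice f).
Proof.
by move=> fl; apply: tlift_linear => [v|u]; [apply: scale_linearl|apply: scale_linearr].
Qed.

Lemma rslice_linear f : scalar f -> linear (rslice f).
Proof.
by move=> fl; apply: tlift_linear => [v|u]; [apply: scale_linearr|apply: scale_linearl].
Qed.

Lemma lslice_tens f : scalar f -> forall u v, lslice f (u \ox v) = f u *: v.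
Proof.
by move=> fl; apply: tlift_tens => [v|u]; [apply: scale_linearl|apply: scale_linearr].
Qed.

Lemma rslice_tens f : scalar f -> forall u v, rslice f (u \ox v) = f v *: u.
Proof.
by move=> fl; apply: tlift_tens => [v|u]; [apply: scale_linearr|apply: scale_linearl].
Qed.

End Slices.

Lemma lslice_tens_sub (V : lmodType K) (P Q : set V) (f : V -> K) :
  scalar f -> is_subspace Q -> forall t, tens_sub P Q t -> Q (lslice f t).
Proof.
move=> fl QS; apply: span_sub (preim_subspace (lslice_linear fl) QS) _.
by move=> _ [u [v [_ Qv ->]]] /=; rewrite lslice_tens //; apply: subspaceZ.
Qed.

Section TensorRing.
Variables A B : algType K.

Lemma tensM (a a' : A) (b b' : B) :
  (a \ox b) * (a' \ox b') = (a * a') \ox (b * b').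
Proof. exact: tmul_tens. Qed.

Lemma tens1 : 1 = 1 \ox 1 :> tensor A B. Proof. by []. Qed.

Lemma tensor_mull_linear (t : tensor A B) : linear (fun x : tensor A B => t * x).
Proof. exact: tmul_linearr. Qed.

Lemma tensor_mulr_linear (t : tensor A B) : linear (fun x : tensor A B => x * t).
Proof. exact: tmul_linearl. Qed.

End TensorRing.

Lemma tmapM (A B A' B' : algType K) (f : A -> A') (f' : B -> B') :
    linear f -> linear f' -> {morph f : x y / x * y} -> {morph f' : x y / x * y} ->
  {morph tmap f f' : x y / x * y}.
Proof.
move=> fl fl' fM fM' x y; have ml := tmap_linear fl fl'.
elim/tensor_ind: x => [a x x' Hx Hx'|u v].
  by rewrite tensor_mulr_linear !ml Hx Hx' tensor_mulr_linear.
elim/tensor_ind: y => [a y y' Hy Hy'|u' v'].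
  by rewrite tensor_mull_linear !ml Hy Hy' tensor_mull_linear.
by rewrite tensM !tmap_tens // tensM fM fM'.
Qed.

End TensorMaps.

(** An algebra generated by a grouplike g and a (1,g)-primitive h is a bialgebra
    as soon as Delta and epsilon are defined; the coalgebra axioms are checked by
    induction on right multiplication by the generators. *)
Section GeneratedBialgebra.
Variables (K : fieldType) (A : algType K) (g h : A).
Variables (D : A -> tensor A A) (eps : A -> K).
Hypothesis A_ind : forall P : A -> Prop,
  (forall a x y, P x -> P y -> P (a *: x + y)) -> P 1 ->
  (forall x, P x -> P (x * g)) -> (forall x, P x -> P (x * h)) -> forall x, P x.
Hypothesis D_linear : linear D.
Hypothesis D1 : D 1 = 1.
Hypothesis D_g : forall x, D (x * g) = D x * (g \ox g).
Hypothesis D_h : forall x, D (x * h) = D x * (1 \ox h + h \ox g).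
Hypothesis eps_linear : scalar eps.
Hypothesis eps1 : eps 1 = 1.
Hypothesis eps_g : forall x, eps (x * g) = eps x.
Hypothesis eps_h : forall x, eps (x * h) = 0.

Lemma comulM : {morph D : x y / x * y}.
Proof.
move=> x; apply: A_ind => [a y z Hy Hz||y Hy|y Hy].
- by rewrite mulrDr -scalerAr !D_linear Hy Hz tensor_mull_linear.
- by rewrite mulr1 D1 mulr1.
- by rewrite mulrA !D_g Hy mulrA.
- by rewrite mulrA !D_h Hy mulrA.
Qed.

Lemma comul_gen_g : D g = g \ox g.
Proof. by rewrite -[g in LHS]mul1r D_g D1 mul1r. Qed.

Lemma comul_gen_h : D h = 1 \ox h + h \ox g.
Proof. by rewrite -[h in LHS]mul1r D_h D1 mul1r. Qed.

Lemma counit_gen_g : eps g = 1.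
Proof. by rewrite -[g]mul1r eps_g eps1. Qed.

Lemma counit_gen_h : eps h = 0.
Proof. by rewrite -[h]mul1r eps_h. Qed.

Lemma counitM : {morph eps : x y / x * y}.
Proof.
move=> x; apply: A_ind => [a y z Hy Hz||y Hy|y Hy].
- by rewrite mulrDr -scalerAr !eps_linear Hy Hz mulrDr mulrCA.
- by rewrite mulr1 eps1 mulr1.
- by rewrite mulrA !eps_g Hy.
- by rewrite mulrA !eps_h mulr0.
Qed.

Lemma counitl_gen x : lslice eps (D x) = x.
Proof.
set c := lslice _.
have cl : linear c := lslice_linear eps_linear.
have ct u v : c (u \ox v) = eps u *: v := lslice_tens eps_linear u v.
have cM s u v : c (s * (u \ox v)) = c s * (eps u *: v).
  elim/tensor_ind: s => [a s t Hs Ht|u' v'].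
    by rewrite tensor_mulr_linear !cl Hs Ht mulrDl scalerAl.
  by rewrite tensM !ct counitM -scalerAl -scalerAr scalerA.
elim/A_ind: x => [a x y Hx Hy||x Hx|x Hx].
- by rewrite D_linear cl Hx Hy.
- by rewrite D1 tens1 ct eps1 scale1r.
- by rewrite D_g cM Hx counit_gen_g scale1r.
- rewrite D_h mulrDr (linear_funD cl) !cM Hx eps1 scale1r.
  by rewrite counit_gen_h scale0r mulr0 addr0.
Qed.

Lemma counitr_gen x : rslice eps (D x) = x.
Proof.
set c := rslice _.
have cl : linear c := rslice_linear eps_linear.
have ct u v : c (u \ox v) = eps v *: u := rslice_tens eps_linear u v.
have cM s u v : c (s * (u \ox v)) = c s * (eps v *: u).
  elim/tensor_ind: s => [a s t Hs Ht|u' v'].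
    by rewrite tensor_mulr_linear !cl Hs Ht mulrDl scalerAl.
  by rewrite tensM !ct counitM -scalerAl -scalerAr scalerA.
elim/A_ind: x => [a x y Hx Hy||x Hx|x Hx].
- by rewrite D_linear cl Hx Hy.
- by rewrite D1 tens1 ct eps1 scale1r.
- by rewrite D_g cM Hx counit_gen_g scale1r.
- rewrite D_h mulrDr (linear_funD cl) !cM Hx counit_gen_g scale1r.
  by rewrite counit_gen_h scale0r mulr0 add0r.
Qed.

(** Contracting with f and then with epsilon is contracting with f alone, by the
    counit axiom. *)
Lemma counit_lslice (f : A -> K) x : scalar f -> eps (lslice f (D x)) = f x.
Proof.
move=> fl; rewrite -[x in RHS]counitr_gen.
elim/tensor_ind: (D x) => [a s t Hs Ht|u v].
  rewrite (lslice_linear fl) (rslice_linear eps_linear).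
  by rewrite eps_linear fl Hs Ht.
rewrite lslice_tens // rslice_tens // !(linear_funZ (W := K^o)) //.
exact: mulrC.
Qed.

(** Right multiplication by [a \ox (b \ox c)] on the triple tensor product, where
    it replaces a ring structure. *)
Definition mulr3 (a b c : A) : tensor A (tensor A A) -> tensor A (tensor A A) :=
  tmap ( *%R^~ a) (tmap ( *%R^~ b) ( *%R^~ c)).

Lemma mulr3_linear a b c : linear (mulr3 a b c).
Proof. by apply: tmap_linear (tmap_linear _ _); apply: mulr_linear. Qed.

Lemma mulr3_tens a b c t x :
  mulr3 a b c (x \ox t) = (x * a) \ox tmap ( *%R^~ b) ( *%R^~ c) t.
Proof. by apply: tmap_tens (tmap_linear _ _) _ _; apply: mulr_linear. Qed.

Lemma mul_tens_tmap (b c : A) (t : tensor A A) :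
  t * (b \ox c) = tmap ( *%R^~ b) ( *%R^~ c) t.
Proof.
apply: (@tensor_ext _ _ _ _ (fun t : tensor A A => t * (b \ox c))) t => [||u v /=].
- exact: tensor_mulr_linear.
- by apply: tmap_linear; apply: mulr_linear.
- by rewrite tensM tmap_tens //; apply: mulr_linear.
Qed.

Lemma id_linear (V : lmodType K) : linear (@id V). Proof. by []. Qed.

Let comul2l (t : tensor A A) : tensor A (tensor A A) := tassoc (tmap D id t).
Let comul2r (t : tensor A A) : tensor A (tensor A A) := tmap id D t.

Let comul2l_linear : linear comul2l.
Proof.
move=> a x y; rewrite /comul2l (tmap_linear D_linear (@id_linear A)).
exact: tassoc_linear.
Qed.

Let comul2r_linear : linear comul2r.
Proof. exact: tmap_linear (@id_linear A) D_linear. Qed.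

(** Both iterated coproducts turn right multiplication by a pure tensor into the
    same kind of operators; coassociativity reduces to the generators. *)
Let comul2l_mul (a b : A) (l : seq (A * A)) t :
  (forall x, D (x * a) = \sum_(p <- l) D x * (p.1 \ox p.2)) ->
  comul2l (t * (a \ox b)) = \sum_(p <- l) mulr3 p.1 p.2 b (comul2l t).
Proof.
move=> Da; elim/tensor_ind: t => [c s t Hs Ht|u v].
  rewrite tensor_mulr_linear !comul2l_linear Hs Ht scaler_sumr -big_split /=.
  by apply: eq_bigr => p _; rewrite mulr3_linear.
rewrite /comul2l tensM !(tmap_tens D_linear (@id_linear A)) Da.
rewrite (linear_fun_sum (tens_linearl _)) (linear_fun_sum (@tassoc_linear _ _ _ _)).
apply: eq_bigr => -[c d] _ /=.
elim/tensor_ind: (D u) => [k s t Hs Ht|x y].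
  rewrite tensor_mulr_linear !tens_linearl !tassoc_linear Hs Ht.
  by rewrite mulr3_linear.
rewrite tensM !tassoc_tens mulr3_tens -mul_tens_tmap.
by rewrite tensM.
Qed.

Let comul2r_mul (a b : A) (l : seq (A * A)) t :
  (forall x, D (x * b) = \sum_(p <- l) D x * (p.1 \ox p.2)) ->
  comul2r (t * (a \ox b)) = \sum_(p <- l) mulr3 a p.1 p.2 (comul2r t).
Proof.
move=> Db; elim/tensor_ind: t => [c s t Hs Ht|u v].
  rewrite tensor_mulr_linear !comul2r_linear Hs Ht scaler_sumr -big_split /=.
  by apply: eq_bigr => p _; rewrite mulr3_linear.
rewrite /comul2r tensM !(tmap_tens (@id_linear A) D_linear) Db.
rewrite (linear_fun_sum (tens_linearr _)); apply: eq_bigr => p _.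
by rewrite mulr3_tens mul_tens_tmap.
Qed.

Lemma comulA_gen x : tassoc (tmap D id (D x)) = tmap id D (D x).
Proof.
rewrite -/(comul2l (D x)) -/(comul2r (D x)).
have D_1 y : D (y * 1) = \sum_(p <- [:: (1 : A, 1 : A)]) D y * (p.1 \ox p.2).
  by rewrite big_seq1 mulr1 -tens1 mulr1.
have Dg y : D (y * g) = \sum_(p <- [:: (g, g)]) D y * (p.1 \ox p.2).
  by rewrite big_seq1 D_g.
have Dh y : D (y * h) = \sum_(p <- [:: (1 : A, h); (h, g)]) D y * (p.1 \ox p.2).
  by rewrite big_cons big_seq1 D_h mulrDr.
elim/A_ind: x => [a x y Hx Hy||x Hx|x Hx].
- by rewrite D_linear comul2l_linear comul2r_linear Hx Hy.
- rewrite D1 tens1 /comul2l /comul2r.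
  rewrite !(tmap_tens D_linear, tmap_tens _ D_linear) //.
  by rewrite D1 tens1 tassoc_tens.
- by rewrite D_g (comul2l_mul _ _ Dg) (comul2r_mul _ _ Dg) !big_seq1 Hx.
- rewrite D_h mulrDr (linear_funD comul2l_linear) (linear_funD comul2r_linear).
  rewrite (comul2l_mul _ _ D_1) (comul2l_mul _ _ Dh) (comul2r_mul _ _ Dh).
  by rewrite (comul2r_mul _ _ Dg) !(big_cons, big_nil) !addr0 /= Hx addrA.
Qed.

Lemma generated_bialgebra : is_bialgebra D eps.
Proof.
split; last 2 first.
- by split=> //; apply: comulM.
- by split=> //; apply: counitM.
split=> //; [exact: comulA_gen|exact: counitl_gen|exact: counitr_gen].
Qed.

End GeneratedBialgebra.

(** * A commutative model and the independence of the monomials *)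

Lemma derivation_bracket (R : nzRingType) (x p dp y dy : R) :
  x * (p * y) + (dp * y + p * dy) - (x * p + dp) * y = p * dy.
Proof.
by rewrite mulrDl mulrA opprD addrACA subrr add0r addrAC subrr add0r.
Qed.

Lemma coef1M (R : nzRingType) (p q : {poly R}) :
  (p * q)`_1 = p`_1 * q`_0 + p`_0 * q`_1.
Proof. by rewrite coefM !big_ord_recl big_ord0 addr0 addrC. Qed.

Section CommutativeMonomials.
Local Notation mon := {cmonom nat}.

(** Induction on the degree of a commutative monomial, one variable at a time. *)
Lemma cmonom_ind (Q : mon -> Prop) :
  Q mone -> (forall k m, Q m -> Q (mmul (ucm k) m)) -> forall m, Q m.
Proof.
move=> Q1 QM m; have [n] := ubnP (mdeg m); elim: n m => // n IH m mn.
have [m0|] := posnP (mdeg m); first by rewrite (mdeg_eq0I m0).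
rewrite lt0n mdeg_eq0 => m1.
have [k mk] : exists k, m k != 0%N.
  apply: contrapT => none; case/negP: m1; apply/cmP => k; rewrite cm1.
  by apply/eqP/negPn/negP => mk; apply: none; exists k.
have mE : m = mmul (ucm k) (divcm m (ucm k)).
  apply/eqP/cmP => i; rewrite cmM divcmE cmU.
  by case: eqP => [<-|_]; rewrite ?subn0 // subnKC // lt0n.
rewrite mE; apply: QM; apply: IH.
by move: mn; rewrite {1}mE mdegM mdegU add1n ltnS.
Qed.

Section Eval.
Variables (S : comNzRingType) (v : nat -> S).

Definition cmeval (m : mon) : S := \prod_(k <- finsupp m) v k ^+ m k.

Lemma cmevalEw (d : {fset nat}) (m : mon) : (finsupp m `<=` d)%fset ->
  cmeval m = \prod_(k <- d) v k ^+ m k.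
Proof.
move=> le; rewrite /cmeval (big_fset_incl _ le) //= => k _.
by rewrite -cmE_eq0 => /eqP ->; rewrite expr0.
Qed.

Lemma cmevalU k : cmeval (ucm k) = v k.
Proof. by rewrite /cmeval mdomU big_seq_fset1 cmUU expr1. Qed.

Lemma cmeval_morphism : mmorphism cmeval.
Proof.
split=> [m m'|]; last by rewrite /cmeval mdom1 big_seq_fset0.
set d := (finsupp m `|` finsupp m')%fset.
rewrite (@cmevalEw d) ?mdomD // (@cmevalEw d m) ?fsubsetUl //.
rewrite (@cmevalEw d m') ?fsubsetUr // -big_split /=.
by apply: eq_bigr => k _; rewrite cmM exprD.
Qed.

HB.instance Definition _ := isMultiplicative.Build mon S cmeval cmeval_morphism.

End Eval.

Definition cmpow (k n : nat) : mon := iter n (mmul (ucm k)) mone.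

Lemma cmpowE k n i : cmpow k n i = ((k == i) * n)%N.
Proof.
elim: n => [|n IH]; first by rewrite /= cm1 muln0.
by rewrite [cmpow _ _]/= cmM IH cmU mulnS.
Qed.

End CommutativeMonomials.

Section Model.
Variable K : fieldType.
Local Notation mon := {cmonom nat}.
Local Notation P := {malg K[mon]}.
Implicit Types p q : P.

Definition mvar (k : nat) : P := << ucm k >>.

Lemma malg_monM (m m' : mon) : << mmul m m' >> = << m >> * << m' >> :> P.
Proof. by rewrite malgM_def fgmulUU mulr1. Qed.

Lemma malg_varM k m : << mmul (ucm k) m >> = mvar k * << m >>.
Proof. exact: malg_monM. Qed.

Lemma mvarX k n : mvar k ^+ n = << cmpow k n >>.
Proof.
elim: n => [|n IH]; first by rewrite expr0.
by rewrite exprS IH [RHS]malg_monM.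
Qed.

(** Values of the derivation on the variables: X_0 stands for h and is killed,
    X_(k+1) stands for a_k. *)
Definition dvar (k : nat) : P := if k is k'.+1 then mvar k.+1 else 0.

Fact dual_key : unit. Proof. by []. Qed.

(** The algebra morphism sending X_k to X_k + (delta X_k) t: its coefficient of t
    is the derivation, and Leibniz' rule is its multiplicativity.
    It is locked to keep the unifier out of its body. *)
Definition dual_lift : P -> {poly P} := locked_with dual_key
  (mmap (polyC \o @mkmalgU _ _ mone) (cmeval (fun k => (mvar k)%:P + dvar k *: 'X))).

Lemma dual_liftD p q : dual_lift (p + q) = dual_lift p + dual_lift q.
Proof. by rewrite /dual_lift unlock; apply: raddfD. Qed.

Lemma dual_lift0 : dual_lift 0 = 0.
Proof. by rewrite /dual_lift unlock; apply: raddf0. Qed.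

Lemma dual_liftM p q : dual_lift (p * q) = dual_lift p * dual_lift q.
Proof. by rewrite /dual_lift unlock; apply: rmorphM. Qed.

Lemma dual_liftZ a p : dual_lift (a *: p) = (a%:MP)%:P * dual_lift p.
Proof. by rewrite /dual_lift unlock; apply: mmapZ. Qed.

Lemma dual_lift1 : dual_lift 1 = 1.
Proof. by rewrite /dual_lift unlock; apply: rmorph1. Qed.

Lemma dual_lift_mvar k : dual_lift (mvar k) = (mvar k)%:P + dvar k *: 'X.
Proof.
by rewrite /dual_lift unlock /mvar mmapU cmevalU [X in X * _](_ : _ = 1) ?mul1r.
Qed.

Lemma dual_lift_coef0 p : (dual_lift p)`_0 = p.
Proof.
elim/malg_ind: p => [a p q Hp Hq||m].
- by rewrite dual_liftD dual_liftZ coefD coefCM Hp Hq mul_malgC.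
- by rewrite dual_lift0 coef0.
elim/cmonom_ind: m => [|k m IH]; first by rewrite -[<< _ >>]/(1 : P) dual_lift1 coef1.
rewrite malg_varM; move: << m >> IH => x IH.
by rewrite dual_liftM coef0M dual_lift_mvar IH coefD coefC coefZ coefX mulr0 addr0.
Qed.

Definition shift_deriv (p : P) : P := (dual_lift p)`_1.

Lemma shift_deriv_linear : linear shift_deriv.
Proof.
move=> a p q.
by rewrite /shift_deriv dual_liftD dual_liftZ coefD coefCM mul_malgC.
Qed.

Lemma shift_derivM p q : shift_deriv (p * q) = shift_deriv p * q + p * shift_deriv q.
Proof.
by rewrite /shift_deriv dual_liftM coef1M (dual_lift_coef0 p) (dual_lift_coef0 q).
Qed.

Lemma shift_deriv_mvar k : shift_deriv (mvar k) = dvar k.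
Proof.
by rewrite /shift_deriv dual_lift_mvar coefD coefC coefZ coefX /= mulr1 add0r.
Qed.

Lemma shift_deriv_mvar0X n : shift_deriv (mvar 0 ^+ n) = 0.
Proof.
elim: n => [|n IH]; first by rewrite expr0 /shift_deriv dual_lift1 coef1.
by rewrite exprS shift_derivM IH shift_deriv_mvar mul0r mulr0 addr0.
Qed.

(** The operators of g and h on polynomials. *)
Definition model_act (l : bool) (p : P) : P :=
  if l == letter_g then p * mvar 1 else mvar 0 * p + shift_deriv p.

Lemma model_act_linear l : linear (model_act l).
Proof.
case: l => a p q; rewrite /model_act /=; last by rewrite mulrDl scalerAl.
by rewrite mulrDr -scalerAr shift_deriv_linear scalerDr addrACA.
Qed.

(** The bracket of multiplication by p with X_0 + delta is multiplication by
    delta p, so a_k acts by X_(k+1) and these operators commute. *)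
Lemma model_e_act k p : e_act model_act k p = p * mvar k.+1.
Proof.
elim: k p => [|k IH] p; first by [].
rewrite /e_act -/(e_act model_act k) !IH /model_act /= shift_derivM shift_deriv_mvar.
exact: derivation_bracket.
Qed.

Lemma model_e_actC i j p :
  e_act model_act i (e_act model_act j p) = e_act model_act j (e_act model_act i p).
Proof.
rewrite (model_e_act j p) (model_e_act i p) (model_e_act i _) (model_e_act j _).
exact: mulrAC.
Qed.

(** [phi] is the orbit map of 1 in the polynomial representation. *)
Section Independence.
Variables (A : algType K) (g h : A) (phi : A -> P).
Hypothesis eC : forall i j,
  ad_iter g h i * ad_iter g h j = ad_iter g h j * ad_iter g h i.
Hypothesis phi_linear : linear phi.
Hypothesis phi1 : phi 1 = 1.
Hypothesis phi_g : forall x, phi (x * g) = model_act letter_g (phi x).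
Hypothesis phi_h : forall x, phi (x * h) = model_act letter_h (phi x).

Local Notation e := (ad_iter g h).
Local Notation w := (gh_pow g h).
Local Notation ad_mon := (ad_mon g h).

Lemma phi_e k x : phi (x * e k) = phi x * mvar k.+1.
Proof.
rewrite -model_e_act; elim: k x => [|k IH] x; first exact: phi_g.
rewrite [LHS]/= -/(e k) /adr mulrBr !mulrA (linear_funB phi_linear).
by rewrite phi_h !IH phi_h.
Qed.

Lemma phi_hX n : phi (h ^+ n) = mvar 0 ^+ n.
Proof.
elim: n => [|n IH]; first by rewrite !expr0 phi1.
by rewrite exprSr phi_h IH /model_act /= shift_deriv_mvar0X addr0 exprS.
Qed.

Definition exp_mon (s : seq (nat * nat)) : mon :=
  foldr (fun ne => mmul (cmpow ne.1.+1 ne.2)) mone s.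

Lemma exp_mon0 s : exp_mon s 0%N = 0%N.
Proof. by elim: s => [|p s IH] /=; rewrite ?cm1 // cmM IH cmpowE. Qed.

Lemma exp_monS s k : exp_mon s k.+1 = expo s k.
Proof.
elim: s => [|p s IH] /=; first by rewrite cm1 /expo big_nil.
rewrite cmM IH cmpowE /expo big_cons eqSS.
by case: eqP; rewrite ?mul1n ?mul0n.
Qed.

Lemma phi_emon x s : phi (x * ad_mon s) = phi x * << exp_mon s >>.
Proof.
elim: s x => [|p s IH] x; first by rewrite /ad_mon big_nil !mulr1.
rewrite /ad_mon big_cons -/(ad_mon s) mulrA IH malg_monM mulrA -mvarX.
congr (_ * _); elim: (p.2) x => [|n IHn] x; first by rewrite !expr0 !mulr1.
by rewrite !exprSr !mulrA phi_e IHn.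
Qed.

Lemma phi_w_emon m s : phi (w m * ad_mon s) =
  \sum_(k < m.+1)
    << mmul (cmpow 0 (m - k)) (mmul (ucm k.+1) (exp_mon s)) >> *+ 'C(m, k).
Proof.
have -> : w m = e 0 * h ^+ m by [].
rewrite phi_emon e_mulhX (linear_fun_sum phi_linear) mulr_suml.
apply: eq_bigr => k _; rewrite (linear_funMn phi_linear) phi_e phi_hX mulrnAl.
by rewrite add0n mvarX !malg_monM mulrA.
Qed.

(** The label of a basis element is the leading monomial of its image by [phi],
    for the degree in X_0.  The monomials g a^mu are labelled as the monomials
    a_0 a^mu, to which they are equal. *)
Definition has_label (x : A) (nu : mon) : Prop :=
  (exists2 s, x = ad_mon s & nu = exp_mon s) \/
  (exists m s, x = w m.+1 * ad_mon s /\
     nu = mmul (cmpow 0 m.+1) (mmul (ucm 1) (exp_mon s))).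

Lemma label_ex x : ext_basis g h x -> exists nu, has_label x nu.
Proof.
move=> [[s _ ->]|[[|m] [s [_ ->]]]].
- by exists (exp_mon s); left; exists s.
- exists (exp_mon ((0%N, 1%N) :: s)); left; exists ((0%N, 1%N) :: s) => //.
  by rewrite /ad_mon big_cons /= expr1 w0.
- by exists (mmul (cmpow 0 m.+1) (mmul (ucm 1) (exp_mon s))); right; exists m, s.
Qed.

(** The exponent of X_0 in the label tells the two kinds of monomials apart, and
    the other exponents determine the factor a^mu. *)
Lemma label_inj x y nu : has_label x nu -> has_label y nu -> x = y.
Proof.
have ex0 m s : mmul (cmpow 0 m.+1) (mmul (ucm 1) (exp_mon s)) 0%N = m.+1.
  by rewrite cmM cmpowE cmM cmU exp_mon0 /= mul1n !addn0.
move=> [[s ->]|[m [s [-> ]]]] -> [[s' ->]|[m' [s' [-> ]]]] ss'.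
- by apply: emon_expo => // k; rewrite -!exp_monS ss'.
- by have := ex0 m' s'; rewrite -ss' exp_mon0.
- by have := ex0 m s; rewrite ss' exp_mon0.
have mm' : m = m' by apply: succn_inj; rewrite -(ex0 m s) ss' ex0.
rewrite mm'; congr (_ * _); apply: emon_expo => // k.
apply/eqP; have /(congr1 (fun nu : mon => nu k.+1)) := ss'.
by rewrite !cmM !exp_monS mm' => /eqP; rewrite !eqn_add2l.
Qed.

(** Up to the degree in X_0 of its own label, the image of a basis element
    contains no other monomial than this label. *)
Lemma label_coef y (nu' nu : mon) : has_label y nu' -> (nu' 0 <= nu 0)%N ->
  (phi y)@_nu = (nu' == nu)%:R.
Proof.
move=> [[s -> ->] _|[m [s [-> ->]]]].
  by rewrite -[ad_mon s]mul1r phi_emon phi1 mul1r mcoeffU1.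
rewrite cmM cmpowE cmM cmU exp_mon0 /= mul1n !addn0 => le_m.
rewrite phi_w_emon raddf_sum big_ord_recl /= big1 => [|k _].
  by rewrite addr0 bin0 mulr1n mcoeffU1.
rewrite mcoeffMn mcoeffU1; case: eqP => [nuE|]; last by rewrite mul0rn.
move: le_m; rewrite -nuE cmM cmpowE cmM cmU exp_mon0 /= mul1n !addn0 /bump /=.
by rewrite add1n subSS ltnNge leq_subr.
Qed.

Definition label (x : A) : mon := xget mone [set nu | has_label x nu].

Lemma labelP x : ext_basis g h x -> has_label x (label x).
Proof. by move=> /label_ex; apply: xgetPex. Qed.

Lemma coef_phi_scalar nu : scalar (fun x => (phi x)@_nu).
Proof. by move=> a x y; rewrite phi_linear mcoeffD mcoeffZ. Qed.

Lemma label_diag x : ext_basis g h x -> (phi x)@_(label x) != 0.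
Proof. by move=> /labelP lx; rewrite (label_coef lx) // eqxx oner_eq0. Qed.

Lemma label_tri x y : ext_basis g h x -> ext_basis g h y -> x != y ->
  (label y 0 <= label x 0)%N -> (phi y)@_(label x) = 0.
Proof.
move=> /labelP lx /labelP ly xy le_yx; rewrite (label_coef ly le_yx).
case: eqP => // yx; case/eqP: xy; apply: label_inj lx _.
by rewrite -yx.
Qed.

Lemma ext_basis_indep : lin_indep (ext_basis g h).
Proof.
exact: (triangular_indep (fun x => coef_phi_scalar (label x)) label_diag label_tri).
Qed.

Lemma phi_separates x : fdb_ext g h x -> x != 0 -> exists nu, (phi x)@_nu != 0.
Proof.
rewrite -(ext_basis_span eC) => Bx x0.
have [y _ yx] := triangular_separates (fun x => coef_phi_scalar (label x))
  label_diag label_tri Bx x0.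
by exists (label y).
Qed.

Lemma phi_gX k : phi (g ^+ k) = << cmpow 1 k >>.
Proof.
rewrite -mvarX; elim: k => [|k IH]; first by rewrite !expr0 phi1.
by rewrite !exprSr phi_g IH.
Qed.

Lemma cmpow_inj k : injective (cmpow k).
Proof.
by move=> m n /(congr1 (fun nu : mon => nu k)); rewrite !cmpowE eqxx !mul1n.
Qed.

End Independence.
End Model.

(** * Graded tensors *)

Section GradedTensors.
Variables (K : fieldType) (A : algType K).
Implicit Types (P Q : set A) (U V : nat -> set A).

Lemma span_bilinear (V1 V2 V3 : lmodType K) (f : V1 -> V2 -> V3)
    (X : set V1) (Y : set V2) (S : set V3) :
  (forall y, linear (f^~ y)) -> (forall x, linear (f x)) -> is_subspace S ->
  (forall x y, X x -> Y y -> S (f x y)) ->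
  forall x y, span X x -> span Y y -> S (f x y).
Proof.
move=> fl fr SS XY x y Xx Yy.
have: [set x | S (f x y)] x; last by [].
move: x Xx; apply: span_sub; first exact: preim_subspace (fl y) SS.
move=> x Xx; have: [set y | S (f x y)] y; last by [].
move: y Yy; apply: span_sub; first exact: preim_subspace (fr x) SS.
by move=> y Yy; apply: XY.
Qed.

Lemma tens_subM P Q : is_subalgebra P -> is_subalgebra Q -> forall s t,
  tens_sub P Q s -> tens_sub P Q t -> tens_sub P Q (s * t).
Proof.
move=> [_ _ PM] [_ _ QM]; apply: span_bilinear.
- exact: tensor_mulr_linear.
- exact: tensor_mull_linear.
- exact: span_subspace.
move=> _ _ [u [v [Pu Qv ->]]] [u' [v' [Pu' Qv' ->]]].
apply: sub_span; exists (u * u'), (v * v'); rewrite tensM.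
by split; [apply: PM|apply: QM|].
Qed.

(** The degree n part of the tensor product of two graded families. *)
Definition graded_tens U V (n : nat) : set (tensor A A) :=
  span [set t | exists i u v, [/\ (i <= n)%N, U i u, V (n - i)%N v & t = u \ox v]].

Lemma graded_tens_pure U V i j u v : U i u -> V j v ->
  graded_tens U V (i + j) (u \ox v).
Proof.
by move=> Uu Vv; apply: sub_span; exists i, u, v; rewrite leq_addr addKn.
Qed.

Lemma graded_tens_ind U V n (S : set (tensor A A)) : is_subspace S ->
  (forall i j u v, (i + j)%N = n -> U i u -> V j v -> S (u \ox v)) ->
  graded_tens U V n `<=` S.
Proof.
move=> SS UV; apply: span_sub SS _ => _ [i [u [v [le_in Uu Vv ->]]]].
by apply: UV Uu Vv; apply: subnKC.
Qed.

Lemma graded_tensS U V U' V' n : (forall i, U i `<=` U' i) ->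
  (forall i, V i `<=` V' i) -> graded_tens U V n `<=` graded_tens U' V' n.
Proof.
move=> UU' VV'; apply: graded_tens_ind (span_subspace _) _ => i j u v <-.
by move=> /UU' Uu /VV' Vv; apply: graded_tens_pure.
Qed.

Lemma graded_tens_sub U V P Q n : (forall i, U i `<=` P) ->
  (forall i, V i `<=` Q) -> graded_tens U V n `<=` tens_sub P Q.
Proof.
move=> UP VQ; apply: graded_tens_ind (span_subspace _) _ => i j u v _.
by move=> /UP Pu /VQ Qv; apply: sub_span; exists u, v.
Qed.

Lemma graded_tensM U m n s t :
  (forall i j x y, U i x -> U j y -> U (i + j)%N (x * y)) ->
  graded_tens U U m s -> graded_tens U U n t ->
  graded_tens U U (m + n) (s * t).
Proof.
move=> UM; move: s t; apply: span_bilinear.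
- exact: tensor_mulr_linear.
- exact: tensor_mull_linear.
- exact: span_subspace.
move=> _ _ [i [u [v [im Uu Uv ->]]]] [j [u' [v' [jn Uu' Uv' ->]]]].
have -> : (m + n)%N = ((i + j) + ((m - i) + (n - j)))%N.
  by rewrite addnACA !subnKC.
by rewrite tensM; apply: graded_tens_pure; apply: UM.
Qed.

Variables g h : A.
Local Notation dh := (1 \ox h + h \ox g).

Definition tbracket (t : tensor A A) : tensor A A := t * dh - dh * t.

Lemma tbracket_linear : linear tbracket.
Proof.
move=> a s t; rewrite /tbracket tensor_mulr_linear tensor_mull_linear.
by rewrite scalerBr opprD addrACA.
Qed.

Lemma tbracket_tens u v : v * g = g * v ->
  tbracket (u \ox v) = u \ox adr h v + adr h u \ox (v * g).
Proof.
move=> vg; rewrite /tbracket mulrDr mulrDl !tensM !mulr1 !mul1r -vg /adr.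
rewrite (linear_funB (tens_linearr u)) (linear_funB (tens_linearl _)).
by rewrite opprD addrACA.
Qed.

(** Each bracket with Delta(h) raises one of the two degrees by one. *)
Lemma tbracket_graded U n :
  (forall i u, U i u -> u * g = g * u) -> U 0%N g ->
  (forall i u, U i u -> U i.+1 (adr h u)) ->
  (forall i u, U i u -> U i (u * g)) ->
  graded_tens U U n (iter n tbracket (g \ox g)).
Proof.
move=> Ug U0 Uadr UM; elim: n => [|n IH].
  exact: (graded_tens_pure (i := 0) (j := 0)).
rewrite iterS; apply: span_image tbracket_linear _ _ IH.
move=> _ [i [u [v [le_in Uu Uv ->]]]]; rewrite tbracket_tens; last exact: Ug Uv.
apply: (subspaceD (span_subspace _)).
  have -> : n.+1 = (i + (n - i).+1)%N by rewrite addnS subnKC.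
  by apply: graded_tens_pure => //; apply: Uadr.
have -> : n.+1 = (i.+1 + (n - i))%N by rewrite addSn subnKC.
by apply: graded_tens_pure; [apply: Uadr|apply: UM].
Qed.

Lemma mulr_dh_graded U V n t :
  (forall i u, U i u -> U i.+1 (u * h)) ->
  (forall i v, V i v -> V i (v * g)) -> (forall i v, V i v -> V i.+1 (v * h)) ->
  graded_tens U V n t -> graded_tens U V n.+1 (t * dh).
Proof.
move=> Uh Vg Vh; apply: (span_image (@tensor_mulr_linear _ _ _ dh)).
move=> _ [i [u [v [le_in Uu Vv ->]]]]; rewrite mulrDr !tensM mulr1.
apply: (subspaceD (span_subspace _)).
  have -> : n.+1 = (i + (n - i).+1)%N by rewrite addnS subnKC.
  by apply: graded_tens_pure => //; apply: Vh.
have -> : n.+1 = (i.+1 + (n - i))%N by rewrite addSn subnKC.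
by apply: graded_tens_pure; [apply: Uh|apply: Vg].
Qed.

(** The commutative algebra generated by the a_k. *)
Definition e_alg : set A := subalg_gen [set x | exists k, x = ad_iter g h k].

Hypothesis eC : forall i j,
  ad_iter g h i * ad_iter g h j = ad_iter g h j * ad_iter g h i.

Lemma centralizer_subalg (X : set A) :
  is_subalgebra [set x | forall y, X y -> x * y = y * x].
Proof.
split=> [|y _|x y Cx Cy z Xz] /=; rewrite ?mul1r ?mulr1 //; last first.
  by rewrite -mulrA Cy // !mulrA Cx.
split=> [y _|a x y Cx Cy z Xz] /=; first by rewrite mul0r mulr0.
by rewrite mulrDl mulrDr -scalerAl -scalerAr Cx // Cy.
Qed.

Lemma subalg_gen_commute (X Y : set A) :
  (forall x y, X x -> Y y -> x * y = y * x) ->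
  forall x y, subalg_gen X x -> Y y -> x * y = y * x.
Proof.
move=> XY x y Xx; move: y.
move: x Xx; apply: subalg_gen_sub; first exact: centralizer_subalg.
by move=> x Xx y; apply: XY.
Qed.

Lemma e_algC x y : e_alg x -> e_alg y -> x * y = y * x.
Proof.
move: x y; apply: subalg_gen_commute => _ y [i ->] Ey; apply: esym.
apply: (subalg_gen_commute (Y := [set ad_iter g h i])) Ey _ => // _ _ [j ->] ->.
exact: eC.
Qed.

Lemma e_alg_g : e_alg g.
Proof. by apply: sub_subalg_gen; exists 0%N. Qed.

Lemma e_alg_adr x : e_alg x -> e_alg (adr h x).
Proof.
have [ES E1 EM] := subalg_gen_subalg [set x | exists k, x = ad_iter g h k].
move=> Ex; suff: [set x | e_alg x /\ e_alg (adr h x)] x by case.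
move: x Ex; apply: subalg_gen_sub => [|_ [k ->]] /=; last first.
  by split; apply: sub_subalg_gen; [exists k|exists k.+1].
split=> [||x y [Ex Ex'] [Ey Ey']] /=.
- split=> [|a x y [Ex Ex'] [Ey Ey']]; split; rewrite ?/adr ?mul0r ?mulr0 ?subr0.
  + exact: ES.1.
  + exact: ES.1.
  + exact: ES.2.
  + rewrite mulrDl mulrDr -scalerAl -scalerAr opprD addrACA -scalerBr.
    exact: ES.2.
- by rewrite /adr mul1r mulr1 subrr; split=> //; apply: ES.1.
have -> : adr h (x * y) = adr h x * y + x * adr h y.
  by rewrite /adr mulrBl mulrBr !mulrA [RHS]addrC addrA subrK.
by split; [apply: EM|apply: (subspaceD ES); apply: EM].
Qed.

(** Tensors with entries in a commuting set commute. *)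
Lemma tens_sub_commute P s t : (forall x y, P x -> P y -> x * y = y * x) ->
  tens_sub P P s -> tens_sub P P t -> s * t = t * s.
Proof.
move=> PC Ps Pt; have: [set s | s * t = t * s] s; last by [].
move: s Ps; apply: span_sub => [|_ [u [v [Pu Pv ->]]] /=].
  split=> [|a x y /= xt yt]; first by rewrite /= mul0r mulr0.
  by rewrite tensor_mulr_linear tensor_mull_linear xt yt.
have: [set t | (u \ox v) * t = t * (u \ox v)] t; last by [].
move: t Pt; apply: span_sub => [|_ [u' [v' [Pu' Pv' ->]]] /=].
  split=> [|a x y /= xt yt]; first by rewrite /= mul0r mulr0.
  by rewrite tensor_mulr_linear tensor_mull_linear xt yt.
by rewrite !tensM (PC u u') // (PC v v').
Qed.

(** The elements that will be the coproducts of the a_k commute; this is what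
    makes the comultiplication descend to the quotient. *)
Lemma iter_tbracketC i j :
  iter i tbracket (g \ox g) * iter j tbracket (g \ox g) =
  iter j tbracket (g \ox g) * iter i tbracket (g \ox g).
Proof.
have [_ _ EM] := subalg_gen_subalg [set x | exists k, x = ad_iter g h k].
have Eg := e_alg_g; have EC := e_algC.
suff tE k : tens_sub e_alg e_alg (iter k tbracket (g \ox g)).
  by apply: (tens_sub_commute _ (tE i) (tE j)).
have gU (_ : nat) u : e_alg u -> u * g = g * u by move=> Eu; apply: EC.
have adrU (_ : nat) u : e_alg u -> e_alg (adr h u) by apply: e_alg_adr.
have mulU (_ : nat) u : e_alg u -> e_alg (u * g) by move=> Eu; apply: EM.
have := @tbracket_graded (fun=> e_alg) k gU Eg adrU mulU.
by apply: graded_tens_sub => _ x.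
Qed.

End GradedTensors.

(** * Grading and coradical *)

(** Padding with zeros makes two finite sums comparable. *)
Lemma sum_subspace (K : fieldType) (V : lmodType K) (G : nat -> set V) :
  (forall n, is_subspace (G n)) ->
  is_subspace [set x | exists N (y : nat -> V),
    (forall n, G n (y n)) /\ x = \sum_(n < N) y n].
Proof.
move=> GS; split=> [|a _ _ [N [y [Gy ->]]] [N' [y' [Gy' ->]]]] /=.
  by exists 0%N, (fun=> 0); rewrite big_ord0; split=> // n; apply: (GS n).1.
pose cut (M : nat) (z : nat -> V) n := if (n < M)%N then z n else 0.
have Gcut M z n : (forall k, G k (z k)) -> G n (cut M z n).
  by move=> Gz; rewrite /cut; case: ifP => // _; apply: (GS n).1.
have cutE M M' (z : nat -> V) : (M <= M')%N ->
    \sum_(n < M) z n = \sum_(n < M') cut M z n.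
  move=> MM'; rewrite (big_ord_widen M' z MM') big_mkcond /=.
  by apply: eq_bigr => n _; rewrite /cut.
exists (maxn N N'), (fun n => a *: cut N y n + cut N' y' n).
split=> [n|]; first by apply: (GS n).2; apply: Gcut.
rewrite (cutE N (maxn N N')) ?leq_maxl // (cutE N' (maxn N N')) ?leq_maxr //.
by rewrite big_split /= scaler_sumr.
Qed.

Lemma sum_single (K : fieldType) (V : lmodType K) (G : nat -> set V) n x :
  (forall k, is_subspace (G k)) -> G n x ->
  exists N (y : nat -> V), (forall k, G k (y k)) /\ x = \sum_(k < N) y k.
Proof.
move=> GS Gx; exists n.+1, (fun k => if k == n then x else 0); split=> [k|].
  by case: eqP => [->|_] //; apply: (GS k).1.
rewrite big_ord_recr /= eqxx big1 ?add0r // => k _.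
by rewrite ltn_eqF.
Qed.

(** [gpart n] is the projection to degree n, for the degrees 0 of g and 1 of h. *)
Section GradedBialgebra.
Variables (K : fieldType) (A : algType K) (g h : A).
Variables (D : A -> tensor A A) (eps : A -> K) (gpart : nat -> A -> A).
Hypothesis A_ind : forall P : A -> Prop,
  (forall a x y, P x -> P y -> P (a *: x + y)) -> P 1 ->
  (forall x, P x -> P (x * g)) -> (forall x, P x -> P (x * h)) -> forall x, P x.
Hypothesis D_linear : linear D.
Hypothesis D1 : D 1 = 1.
Hypothesis D_g : forall x, D (x * g) = D x * (g \ox g).
Hypothesis D_h : forall x, D (x * h) = D x * (1 \ox h + h \ox g).
Hypothesis eps_linear : scalar eps.
Hypothesis eps1 : eps 1 = 1.
Hypothesis eps_g : forall x, eps (x * g) = eps x.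
Hypothesis eps_h : forall x, eps (x * h) = 0.
Hypothesis gpart_linear : forall n, linear (gpart n).
Hypothesis gpart1 : forall n, gpart n 1 = if n == 0%N then 1 else 0.
Hypothesis gpart_g : forall n x, gpart n (x * g) = gpart n x * g.
Hypothesis gpart_h : forall n x,
  gpart n (x * h) = if n is n'.+1 then gpart n' x * h else 0.
Hypothesis eC : forall i j,
  ad_iter g h i * ad_iter g h j = ad_iter g h j * ad_iter g h i.

Local Notation e := (ad_iter g h).
Local Notation w := (gh_pow g h).
Local Notation B := (fdb_ext g h).
Local Notation S := (fdb_alg g h).
Local Notation D_M := (comulM A_ind D_linear D1 D_g D_h).

Definition homog (n : nat) : set A :=
  [set x | forall k, gpart k x = if k == n then x else 0].

Lemma homog_subspace n : is_subspace (homog n).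
Proof.
split=> [k|a x y hx hy k]; first by rewrite linear_fun0 // if_same.
by rewrite gpart_linear hx hy; case: eqP; rewrite ?scaler0 ?addr0.
Qed.

Lemma homog1 : homog 0 1. Proof. by move=> k; rewrite gpart1. Qed.

(** Left multiplication by an element of degree m shifts the components by m. *)
Lemma gpartM m x : homog m x -> forall y k,
  gpart k (x * y) = if (m <= k)%N then x * gpart (k - m) y else 0.
Proof.
move=> hx; apply: A_ind => [a y z Hy Hz k||y Hy k|y Hy k].
- rewrite mulrDr -scalerAr !gpart_linear Hy Hz; case: ifP => _.
    by rewrite mulrDr -scalerAr.
  by rewrite scaler0 addr0.
- move=> k; rewrite mulr1 hx gpart1 subn_eq0.
  by case: ltngtP; rewrite ?mulr1 ?mulr0.
- by rewrite mulrA gpart_g Hy gpart_g; case: ifP; rewrite ?mulrA ?mul0r.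
rewrite mulrA gpart_h; case: k => [|k].
  by rewrite sub0n gpart_h mulr0 if_same.
rewrite Hy [(m <= k.+1)%N]leq_eqVlt ltnS; case: eqP => [->|_] /=.
  by rewrite ltnn subnn gpart_h mul0r mulr0.
by case: leqP => mk; rewrite ?mul0r // subSn // gpart_h mulrA.
Qed.

Lemma homogM m n x y : homog m x -> homog n y -> homog (m + n) (x * y).
Proof.
move=> hx hy k; rewrite (gpartM hx) hy; case: leqP => [mk|km].
  by rewrite -{2}(subnKC mk) eqn_add2l; case: eqP; rewrite ?mulr0.
by rewrite ltn_eqF // (leq_trans km) ?leq_addr.
Qed.

Lemma homog_g : homog 0 g.
Proof. by move=> k; rewrite -[g]mul1r gpart_g gpart1; case: eqP; rewrite ?mul0r. Qed.

Lemma homog_h : homog 1 h.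
Proof.
move=> k; rewrite -[h]mul1r gpart_h; case: k => // k.
by rewrite gpart1 eqSS; case: eqP; rewrite ?mul0r.
Qed.

Lemma homog_mulh n x : homog n x -> homog n.+1 (x * h).
Proof. by move=> hx; rewrite -addn1; apply: homogM hx homog_h. Qed.

Lemma homog_mulg n x : homog n x -> homog n (x * g).
Proof. by move=> hx; rewrite -[n]addn0; apply: homogM hx homog_g. Qed.

Lemma homog_adr n x : homog n x -> homog n.+1 (adr h x).
Proof.
move=> hx; apply: (subspaceB (homog_subspace _)); first exact: homog_mulh.
by rewrite -add1n; apply: homogM homog_h hx.
Qed.

Lemma homog_e n : homog n (e n).
Proof. by elim: n => [|n IH]; [exact: homog_g|exact: homog_adr]. Qed.

Lemma homog_w n : homog n (w n).
Proof.
elim: n => [|n IH]; first by rewrite w0; apply: homog_g.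
by rewrite wSr; apply: homog_mulh.
Qed.

Definition ext_deg (n : nat) : set A := B `&` homog n.

Lemma ext_subalg : is_subalgebra B. Proof. exact: subalg_gen_subalg. Qed.

Lemma ext_deg_subspace n : is_subspace (ext_deg n).
Proof.
have [BS _ _] := ext_subalg; have HS := homog_subspace n.
split; first by split; apply: subspace0.
by move=> a x y [Bx hx] [By hy]; split; [apply: BS.2|apply: HS.2].
Qed.

Lemma ext_degM m n x y : ext_deg m x -> ext_deg n y -> ext_deg (m + n) (x * y).
Proof.
have [_ _ BM] := ext_subalg; move=> [Bx hx] [By hy].
by split; [apply: BM|apply: homogM].
Qed.

Lemma comul_e n : D (e n) = iter n (tbracket g h) (g \ox g).
Proof.
elim: n => [|n IH]; first exact: (comul_gen_g D1 D_g).
by rewrite [LHS]/= -/(e n) (linear_funB D_linear) !D_M (comul_gen_h D1 D_h) IH.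
Qed.

Lemma e_alg_B : e_alg g h `<=` B.
Proof.
apply: subalg_gen_sub ext_subalg _ => _ [k ->]; exact: e_fdb_ext.
Qed.

Lemma comul_e_graded n : graded_tens ext_deg ext_deg n (D (e n)).
Proof.
have [_ _ EM] := subalg_gen_subalg [set x | exists k, x = e k].
pose U i : set A := e_alg g h `&` homog i.
have UB i : U i `<=` ext_deg i by move=> x [/e_alg_B].
apply: (graded_tensS UB UB); rewrite comul_e; apply: tbracket_graded.
- by move=> i u [Eu _]; apply: (e_algC eC Eu); apply: e_alg_g.
- by split; [apply: e_alg_g|exact: homog_g].
- by move=> i u [Eu hu]; split; [apply: e_alg_adr|apply: homog_adr].
- by move=> i u [Eu hu]; split; [apply: EM => //; apply: e_alg_g|apply: homog_mulg].
Qed.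

(** The right factors occurring in Delta(g h^n) lie in this set.  It contains g,
    since g h^n is a generator, and it is stable under right multiplication by g
    and by h; the algebra [fdb_alg] itself is not stable under h. *)
Definition w_ideal : set A := [set x | forall n, S (x * h ^+ n)].

Lemma comul_w_graded n :
  graded_tens (fun i => S `&` homog i) (fun j => S `&` homog j) n (D (w n)).
Proof.
have [_ _ SM] := subalg_gen_subalg [set x | exists k, x = w k].
(* The left factors are exactly the g h^i. *)
pose U i : set A := [set w i]; pose V j : set A := w_ideal `&` homog j.
have US i : U i `<=` S `&` homog i.
  by move=> _ ->; split; [apply: w_fdb_alg|apply: homog_w].
have VS i : V i `<=` S `&` homog i.
  by move=> x [Sx hx]; split=> //; have := Sx 0%N; rewrite expr0 mulr1.
apply: (graded_tensS US VS); elim: n => [|n IH].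
  rewrite w0 (comul_gen_g D1 D_g); apply: (graded_tens_pure (i := 0) (j := 0)).
    by rewrite /U /= w0.
  by split; [move=> n; apply: w_fdb_alg|exact: homog_g].
rewrite wSr D_h; apply: mulr_dh_graded IH.
- by move=> i _ ->; rewrite /U /= wSr.
- move=> i v [Sv hv]; split; last exact: homog_mulg.
  move=> k; rewrite -mulrA; apply: SM; last exact: w_fdb_alg.
  by have := Sv 0%N; rewrite expr0 mulr1.
- move=> i v [Sv hv]; split; last exact: homog_mulh.
  by move=> k; rewrite -mulrA -exprS.
Qed.

Lemma comul_sub_subalg P : is_subalgebra P ->
  is_subalgebra [set x | tens_sub P P (D x)].
Proof.
move=> PA; have [_ P1 _] := PA; split=> [||x y Px Py] /=.
- exact: preim_subspace D_linear (span_subspace _).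
- by rewrite D1; apply: sub_span; exists 1, 1.
- by rewrite D_M; apply: tens_subM.
Qed.

Lemma fdb_alg_subbialgebra : is_subbialgebra D S.
Proof.
have SA := subalg_gen_subalg [set x | exists k, x = w k]; have [SS _ _] := SA.
split=> //; split=> //; apply: subalg_gen_sub (comul_sub_subalg SA) _.
move=> _ [n ->] /=.
by apply: (graded_tens_sub _ _ (@comul_w_graded n)) => i x; case.
Qed.

Lemma comul_w_ext_graded n : graded_tens ext_deg ext_deg n (D (w n)).
Proof.
by apply: (graded_tensS _ _ (@comul_w_graded n)) => i x [/fdb_alg_ext].
Qed.

Lemma fdb_ext_subbialgebra : is_subbialgebra D B.
Proof.
have [BS _ _] := ext_subalg.
split; first exact: ext_subalg; split=> //.
apply: subalg_gen_sub (comul_sub_subalg ext_subalg) _ => _ [n [->|->]] /=.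
  by apply: (graded_tens_sub _ _ (@comul_w_ext_graded n)) => i x [].
by apply: (graded_tens_sub _ _ (@comul_e_graded n)) => i x [].
Qed.

(** Degree n elements whose coproduct has degree n.  These sets are
    multiplicative and contain the generators, hence exhaust the algebra. *)
Definition comul_deg (n : nat) : set A :=
  [set x | ext_deg n x /\ graded_tens ext_deg ext_deg n (D x)].

Lemma comul_deg_subspace n : is_subspace (comul_deg n).
Proof.
have BS := ext_deg_subspace n.
have TS := preim_subspace D_linear
  (span_subspace _ : is_subspace (graded_tens ext_deg ext_deg n)).
split; first by split; [exact: BS.1|exact: TS.1].
by move=> a x y [Bx Tx] [By Ty]; split; [apply: BS.2|apply: TS.2].
Qed.

Lemma comul_deg_M m n x y : comul_deg m x -> comul_deg n y -> comul_deg (m + n) (x * y).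
Proof.
move=> [Bx Tx] [By Ty]; split; first exact: ext_degM.
by rewrite D_M; apply: graded_tensM => // i j u v; apply: ext_degM.
Qed.

Lemma comul_deg_1 : comul_deg 0 1.
Proof.
have B01 : ext_deg 0 1 by split; [have [] := ext_subalg|exact: homog1].
by split=> //; rewrite D1 tens1; apply: (graded_tens_pure (i := 0) (j := 0)).
Qed.

Lemma comul_deg_w n : comul_deg n (w n).
Proof.
by split; [split; [exact: w_fdb_ext|exact: homog_w]|exact: comul_w_ext_graded].
Qed.

Lemma comul_deg_e n : comul_deg n (e n).
Proof.
by split; [split; [exact: e_fdb_ext|exact: homog_e]|exact: comul_e_graded].
Qed.

Lemma comul_deg_emon s : exists n, comul_deg n (ad_mon g h s).
Proof.
elim: s => [|p s [n Gs]].
  by exists 0%N; rewrite /ad_mon big_nil; apply: comul_deg_1.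
exists (p.2 * p.1 + n)%N; rewrite /ad_mon big_cons; apply: comul_deg_M Gs.
elim: (p.2) => [|k IH]; first by rewrite expr0; apply: comul_deg_1.
by rewrite exprS mulSn; apply: comul_deg_M (comul_deg_e _) IH.
Qed.

Lemma ext_sum_comul_deg x : B x ->
  exists N (y : nat -> A), (forall n, comul_deg n (y n)) /\ x = \sum_(n < N) y n.
Proof.
rewrite -(ext_basis_span eC); move: x.
apply: span_sub (sum_subspace comul_deg_subspace) _ => _ [[s _ ->]|[m [s [_ ->]]]].
  by have [n Gs] := comul_deg_emon s; apply: sum_single comul_deg_subspace Gs.
have [n Gs] := comul_deg_emon s.
exact: sum_single comul_deg_subspace (comul_deg_M (comul_deg_w m) Gs).
Qed.

Lemma gpart_sum N (y : nat -> A) k : (forall n, homog n (y n)) ->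
  gpart k (\sum_(n < N) y n) = if (k < N)%N then y k else 0.
Proof.
move=> hy; rewrite (linear_fun_sum (gpart_linear k)).
case: ltnP => [kN|Nk].
  rewrite (bigD1 (Ordinal kN)) // big1 => [|i /eqP ik]; first by rewrite /= addr0 hy eqxx.
  by rewrite hy; case: eqP => // ki; case: ik; apply: val_inj.
by rewrite big1 // => i _; rewrite hy gtn_eqF // (leq_trans (ltn_ord i)).
Qed.

(** By induction on right multiplication by the generators: a component of
    positive degree of x h is of the form y h, where epsilon vanishes. *)
Lemma homog_eps n x : (0 < n)%N -> homog n x -> eps x = 0.
Proof.
have epsc : forall y k, (0 < k)%N -> eps (gpart k y) = 0.
  apply: A_ind => [a y z Hy Hz k k0|[|k] // _|y Hy k k0|y Hy [|k] // _].
  - by rewrite gpart_linear eps_linear Hy // Hz // mulr0 addr0.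
  - by rewrite gpart1; apply: (linear_fun0 (W := K^o) eps_linear).
  - by rewrite gpart_g eps_g Hy.
  - by rewrite gpart_h eps_h.
by move=> n0 hx; rewrite -(epsc x n n0) hx eqxx.
Qed.

Lemma fdb_ext_grading : is_grading D eps B ext_deg.
Proof.
split.
- exact: ext_deg_subspace.
- by move=> n x [].
- move=> x /ext_sum_comul_deg [N [y [Gy ->]]]; exists N, y; split=> // n.
  by have [] := Gy n.
- move=> N y By y0 n nN; have := gpart_sum N n (fun k => (By k).2).
  by rewrite y0 nN linear_fun0.
- by have [] := comul_deg_1.
- exact: ext_degM.
- move=> n x [/ext_sum_comul_deg [N [y [Gy xE]]] hx].
  have := gpart_sum N n (fun k => (Gy k).1.2); rewrite -xE hx eqxx => ->.
  case: ifP => _; first by have [] := Gy n.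
  by rewrite linear_fun0 //; apply: subspace0 (span_subspace _).
- by move=> n x n0 [_ hx]; apply: homog_eps hx.
Qed.

Lemma homog0_span x : homog 0 x -> span [set y | exists k, y = g ^+ k] x.
Proof.
have LS := span_subspace [set y : A | exists k, y = g ^+ k].
have main y : span [set y | exists k, y = g ^+ k] (gpart 0 y).
  elim/A_ind: y => [a y z Hy Hz||y Hy|y Hy].
  - by rewrite gpart_linear; apply: LS.2.
  - by rewrite gpart1; apply: sub_span; exists 0%N; rewrite expr0.
  - rewrite gpart_g; move: Hy; apply: (span_image (mulr_linear g)).
    by move=> _ [k ->]; apply: sub_span; exists k.+1; rewrite exprSr.
  - by rewrite gpart_h; apply: LS.1.
by move=> hx; have := main x; rewrite hx eqxx.
Qed.

Local Notation P := {malg K[{cmonom nat}]}.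
Variable phi : A -> P.
Hypothesis phi_linear : linear phi.
Hypothesis phi1 : phi 1 = 1.
Hypothesis phi_g : forall x, phi (x * g) = model_act letter_g (phi x).
Hypothesis phi_h : forall x, phi (x * h) = model_act letter_h (phi x).

Lemma comul_gX k : D (g ^+ k) = (g ^+ k) \ox (g ^+ k).
Proof.
elim: k => [|k IH]; first by rewrite !expr0 D1.
by rewrite !exprSr D_g IH tensM.
Qed.

Lemma grouplike_gX k : grouplike D eps (g ^+ k).
Proof.
split; first exact: comul_gX.
by elim: k => [|k IH]; rewrite ?expr0 ?exprSr ?eps_g.
Qed.

(** The functional used on the left factor is a coordinate, in the polynomial
    representation, of the component of top degree n.  It kills the left factors
    of degree different from n; in a term of degree n of Delta(x) the right factor
    then has degree 0. *)
Lemma subcoalg_deg0 C x : is_subcoalgebra D C -> C `<=` B -> C x -> x != 0 ->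
  exists2 z, C z /\ homog 0 z & z != 0.
Proof.
move=> [CS CD] CB Cx x0; have [N [y [Gy xE]]] := ext_sum_comul_deg (CB _ Cx).
have exn : exists n, (n < N)%N && (y n != 0).
  apply: contrapT => none; case/negP: x0; rewrite xE big1 // => i _.
  by apply/eqP/negPn/negP => yi; apply: none; exists i; rewrite ltn_ord.
have len n : (n < N)%N && (y n != 0) -> (n <= N)%N by move=> /andP [/ltnW].
have [n /andP [nN yn0] n_max] := ex_maxnP exn len.
have [nu phin] := phi_separates eC phi_linear phi1 phi_g phi_h (Gy n).1.1 yn0.
(* [nu] is a coordinate that does not vanish on the top component of [x]. *)
pose f u := (phi (gpart n u))@_nu.
have fl : scalar f.
  by move=> a u v; rewrite /f gpart_linear phi_linear mcoeffD mcoeffZ.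
exists (lslice f (D x)).
  split; first exact: (lslice_tens_sub fl CS (CD x Cx)).
  rewrite xE (linear_fun_sum D_linear) (linear_fun_sum (lslice_linear fl)).
  apply: (subspace_sum (homog_subspace 0)) => i _.
  have [ni|le_in] := ltnP n i.
    have -> : y i = 0.
      apply/eqP/negPn/negP => yi; have := n_max i.
      by rewrite ltn_ord yi leqNgt ni => /(_ isT).
    rewrite (linear_fun0 D_linear) (linear_fun0 (lslice_linear fl)).
    exact: (homog_subspace 0).1.
  (* Here [i <= n]: a term of bidegree (a, b) with a = n has b = 0. *)
have hS := preim_subspace (lslice_linear fl) (homog_subspace 0).
  apply: (graded_tens_ind hS _ (Gy i).2) => a b u v abi [_ hu] [_ hv] /=.
  rewrite lslice_tens // /f hu; case: eqP => [na|_]; last first.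
    by rewrite linear_fun0 // mcoeff0 scale0r; apply: (homog_subspace 0).1.
  apply: (subspaceZ (homog_subspace 0)).
  move: hv; suff -> : b = 0%N by [].
  by apply/eqP; rewrite -leqn0 -(leq_add2l a) abi addn0 -na.
apply/eqP => z0; case/negP: phin.
have := counit_lslice A_ind D_linear D1 D_g D_h eps_linear eps1 eps_g eps_h x fl.
rewrite z0 (linear_fun0 (W := K^o) eps_linear) /f xE.
by rewrite (gpart_sum _ _ (fun k => (Gy k).1.2)) nN => <-.
Qed.

(** For z = sum_k c_k g^k the coproduct is diagonal, so a functional dual to g^k
    contracts it to c_k g^k. *)
Lemma subcoalg_gX C x : is_subcoalgebra D C -> C `<=` B -> C x -> x != 0 ->
  exists k, C (g ^+ k).
Proof.
move=> CC CB Cx x0; have [z [Cz /homog0_span zg] z0] := subcoalg_deg0 CC CB Cx x0.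
have [CS CD] := CC; have [s [c [su sg zE]]] := span_expand zg.
have [t ts ct] : exists2 t, t \in s & c t != 0.
  apply: contrapT => none; case/negP: z0; rewrite zE big_seq big1 // => t ts.
  apply/eqP/negPn/negP => ct; apply: none; exists t => //.
  by apply: contraNneq ct => ->; rewrite scale0r.
have [k tk] := sg t ts; exists k; rewrite -tk.
pose f u := (phi u)@_(cmpow 1 k).
have fl : scalar f by move=> a u v; rewrite /f phi_linear mcoeffD mcoeffZ.
have fX j : f (g ^+ j) = (j == k)%:R.
  by rewrite /f (phi_gX phi1 phi_g) mcoeffU1 (inj_eq (@cmpow_inj 1)).
have <- : (c t)^-1 *: lslice f (D z) = t; last first.
  by apply: (subspaceZ CS); apply: (lslice_tens_sub fl CS (CD z Cz)).
rewrite zE (linear_fun_sum D_linear) (linear_fun_sum (lslice_linear fl)).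
rewrite (bigD1_seq t) //= big_seq_cond big1 ?addr0 => [|u /andP [us ut]].
  rewrite (linear_funZ D_linear) (linear_funZ (lslice_linear fl)).
  by rewrite tk comul_gX lslice_tens // fX eqxx scale1r -tk scalerA mulVf ?scale1r.
have [j uj] := sg u us.
rewrite (linear_funZ D_linear) (linear_funZ (lslice_linear fl)).
rewrite uj comul_gX lslice_tens // fX; case: eqP => [jk|_]; last first.
  by rewrite scale0r scaler0.
by case/eqP: ut; rewrite uj tk jk.
Qed.

Lemma grouplike_line_subcoalg x : grouplike D eps x ->
  is_subcoalgebra D [set y | exists a, y = a *: x].
Proof.
move=> [Dx _]; split=> [|_ [a ->]].
  split=> [|a _ _ [b ->] [c ->]]; first by exists 0; rewrite scale0r.
  by exists (a * b + c); rewrite scalerDl scalerA.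
rewrite (linear_funZ D_linear) Dx; apply: (subspaceZ (span_subspace _)).
by apply: sub_span; exists x, x; split=> //; exists 1; rewrite scale1r.
Qed.

Lemma grouplike_neq0 x : grouplike D eps x -> x != 0.
Proof.
move=> [_ ex]; apply/eqP => x0; move: ex.
by rewrite x0 (linear_fun0 (W := K^o) eps_linear) => /eqP; rewrite eq_sym oner_eq0.
Qed.

Lemma grouplike_simple x : grouplike D eps x ->
  is_simple_coalgebra D [set y | exists a, y = a *: x].
Proof.
move=> gx; split; first exact: grouplike_line_subcoalg.
  move=> /(congr1 (fun C : set A => C x)) /= Lx.
  have : x = 0 by rewrite -Lx; exists 1; rewrite scale1r.
  by move/eqP; rewrite (negPf (grouplike_neq0 gx)).
move=> C [CS _] CL; have [[y [Cy y0]]|none] := pselect (exists y, C y /\ y != 0).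
  right; apply/seteqP; split=> // _ [a ->].
  have [b yb] := CL y Cy; have b0 : b != 0.
    by apply: contraNneq y0 => b0; rewrite yb b0 scale0r.
  have -> : a *: x = (a / b) *: y by rewrite yb scalerA divfK.
  exact: (subspaceZ CS).
left; apply/seteqP; split=> [y Cy|_ ->]; last exact: CS.1.
by apply/eqP/negPn/negP => y0; apply: none; exists y.
Qed.

(** A simple subcoalgebra contains the line of some g^k, which is a subcoalgebra,
    so it is that line. *)
Lemma fdb_ext_pointed : is_pointed D eps B.
Proof.
apply/seteqP; split; apply: span_sub (span_subspace _) _ => x.
  move=> [C [[CC C0 Cmin] CB Cx]].
  have [[y [Cy y0]]|none] := pselect (exists y, C y /\ y != 0); last first.
    case: C0; apply/seteqP; split=> [y Cy|_ ->]; last exact: CC.1.1.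
    by apply/eqP/negPn/negP => y0; apply: none; exists y.
  have [k Ck] := subcoalg_gX CC CB Cy y0; have gk := grouplike_gX k.
  have LC : [set y | exists a, y = a *: g ^+ k] `<=` C.
    by move=> _ [a ->]; apply: (subspaceZ CC.1).
  have [_ L0 _] := grouplike_simple gk.
  have [//|LE] := Cmin _ (grouplike_line_subcoalg gk) LC.
  move: Cx; rewrite -LE => -[a ->].
  apply: (subspaceZ (span_subspace _)); apply: sub_span.
  by split=> //; apply: CB.
move=> [Bx gx]; apply: sub_span; exists [set y | exists a, y = a *: x].
split; [exact: grouplike_simple| |by exists 1; rewrite scale1r].
have [BS _ _] := ext_subalg.
by move=> _ [a ->]; apply: (subspaceZ BS).
Qed.

End GradedBialgebra.

(** * The quotient bialgebra *)

Section Quotient.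
Variable K : fieldType.
Local Notation T := (free_alg K).
Local Notation Tb := (Tbar K).
Local Notation pr := (@proj K).
Local Notation gbar := (gbar K).
Local Notation hbar := (hbar K).
Local Notation e := (ad_iter gbar hbar).
Local Notation w := (gh_pow gbar hbar).
Local Notation TT := (tensor Tb Tb).

Definition comul_letter (l : bool) : TT :=
  if l == letter_g then gbar \ox gbar else 1 \ox hbar + hbar \ox gbar.

(** Right multiplication by the coproduct of a letter: the resulting right action
    on the tensor square, applied to 1, is the comultiplication. *)
Definition comul_act (l : bool) (t : TT) : TT := t * comul_letter l.

Lemma comul_act_linear l : linear (comul_act l).
Proof. exact: tensor_mulr_linear. Qed.

Lemma DeltaT_act x :
  DeltaT x = act (fun l (t : tensor T T) => t * DeltaT_letter K l) 1 x.
Proof.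
rewrite /DeltaT /act; apply: eq_bigr => v _; congr (_ *: _).
rewrite -[LHS]mul1r; elim: (fmonom_val v) {1 3}(1 : tensor T T) => [|l u IH] t.
  by rewrite big_nil mulr1.
by rewrite big_cons mulrA IH.
Qed.

Lemma tmap_proj_DeltaT x : tmap pr pr (DeltaT x) = act comul_act 1 x.
Proof.
have dl : forall l, linear (fun t : tensor T T => t * DeltaT_letter K l).
  by move=> l; apply: tensor_mulr_linear.
have pl := @proj_linear K; have tl := tmap_linear pl pl.
elim/free_alg_ind: x => [a x y Hx Hy|v].
  by rewrite !DeltaT_act !act_linear tl -!DeltaT_act Hx Hy.
rewrite DeltaT_act; elim/last_ind: v => [|v l IH].
  by rewrite word_nil !act1 !tens1 tmap_tens // proj1.
rewrite -cats1 wordM (actM dl) (actM comul_act_linear) -IH !act_word /=.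
rewrite (tmapM pl pl (@projM K) (@projM K)); congr (_ * _).
rewrite /DeltaT_letter /comul_letter; case: ifP => _; first by rewrite tmap_tens.
by rewrite (linear_funD tl) !tmap_tens // proj1.
Qed.

Lemma comul_e_act k t :
  e_act comul_act k t = t * iter k (tbracket gbar hbar) (gbar \ox gbar).
Proof.
elim: k t => [|k IH] t; first by [].
rewrite iterS /tbracket -mulr_bracket.
by rewrite -(IH t) -(IH (t * _)).
Qed.

(** The hypothesis of [Tbar_act] for the comultiplication. *)
Lemma comul_e_actC i j t :
  e_act comul_act i (e_act comul_act j t) = e_act comul_act j (e_act comul_act i t).
Proof.
rewrite !comul_e_act -!mulrA; congr (_ * _).
exact: iter_tbracketC (@Tbar_eC K) j i.
Qed.

Lemma DeltaTbar_spec : [/\ linear (@DeltaTbar K), DeltaTbar (1 : Tb) = 1,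
  forall x : Tb, DeltaTbar (x * gbar) = DeltaTbar x * (gbar \ox gbar),
  forall x : Tb, DeltaTbar (x * hbar) = DeltaTbar x * (1 \ox hbar + hbar \ox gbar)
  & forall x, DeltaTbar (pr x) = tmap pr pr (DeltaT x)].
Proof.
have [f [fl f1 fg fh fp]] := Tbar_act (1 : TT) comul_act_linear comul_e_actC.
have fE : @DeltaTbar K = f.
  by apply: funext => x; rewrite /DeltaTbar tmap_proj_DeltaT -fp projK.
by rewrite fE; split=> // x; rewrite fp tmap_proj_DeltaT.
Qed.

Lemma epsT_gen : [/\ epsT (1 : T) = 1, epsT (gT K) = 1 & epsT (hT K) = 0].
Proof.
have epsW v : epsT (word K v) = epsT_word K (FMonom v).
  by rewrite /epsT /word mmapU /= mul1r.
split; first exact: rmorph1 (mmap idfun (@epsT_word K)).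
  by rewrite epsW /epsT_word big_seq1.
by rewrite epsW /epsT_word big_seq1.
Qed.

Lemma epsT_idealT x : @idealT K x -> epsT x = 0.
Proof.
move=> /(@idealT_sub K [set y | epsT y = 0]); apply=> [|i j] /=; last first.
  exact: epsT_commutator.
have el := @epsT_linear K.
split=> [|a y /= y0]; last first.
  by split; [rewrite (epsT_mul a y) y0 mulr0|rewrite (epsT_mul y a) y0 mul0r].
split=> [|a y z /= y0 z0]; first exact: (linear_fun0 (W := K^o) el).
by rewrite el y0 z0 mulr0 addr0.
Qed.

Lemma epsTbar_proj x : epsTbar (pr x) = epsT x.
Proof.
have el := @epsT_linear K; apply/eqP; rewrite /epsTbar -subr_eq0; apply/eqP.
have := linear_funB (W := K^o) el => <-; apply: epsT_idealT.
by apply/proj_eq; rewrite projK.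
Qed.

Lemma epsTbar_spec : [/\ scalar (@epsTbar K), epsTbar (1 : Tb) = 1,
  forall x : Tb, epsTbar (x * gbar) = epsTbar x
  & forall x : Tb, epsTbar (x * hbar) = 0].
Proof.
have [e1 eg eh] := epsT_gen.
split=> [a x y||x|x].
- rewrite -[x in LHS]projK -[y in LHS]projK -proj_linear epsTbar_proj.
  exact: epsT_linear.
- by rewrite -proj1 epsTbar_proj e1.
- by rewrite -[x in LHS]projK -projM epsTbar_proj epsT_mul eg mulr1.
- by rewrite -[x in LHS]projK -projM epsTbar_proj epsT_mul eh mulr0.
Qed.

(** Right multiplication by g and by h on sequences of homogeneous components:
    h shifts the degree. *)
Definition grade_act (l : bool) (F : nat -> Tb) (n : nat) : Tb :=
  if l == letter_g then F n * gbar else if n is n'.+1 then F n' * hbar else 0.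

Lemma grade_act_linear l : linear (grade_act l).
Proof.
move=> a F G; apply: funext => n; rewrite /grade_act.
case: l n => [[|n]|n] /=.
- by rewrite -[RHS]/(a *: (0 : Tb) + 0) scaler0 addr0.
- by rewrite mulrDl -scalerAl.
- by rewrite mulrDl -scalerAl.
Qed.

Lemma grade_e_act k F n :
  e_act grade_act k F n = if (k <= n)%N then F (n - k)%N * e k else 0.
Proof.
elim: k F n => [|k IH] F n; first by rewrite subn0.
rewrite eS -[LHS]/(grade_act letter_h (e_act grade_act k F) n -
  e_act grade_act k (grade_act letter_h F) n) IH /grade_act /=.
case: n => [|n]; first by rewrite sub0n mul0r if_same subrr.
rewrite IH ltnS [(k <= n.+1)%N]leq_eqVlt ltnS; case: eqP => [->|_] /=.
  by rewrite ltnn subnn !mul0r subrr.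
case: leqP => kn; last by rewrite mul0r subrr.
rewrite subSn; last exact: kn.
by rewrite subSS; apply: mulr_bracket.
Qed.

Lemma shift_mulA (R : nzRingType) (F : nat -> R) (x y : R) i j n :
  (if (i <= n)%N then (if (j <= n - i)%N then F (n - i - j)%N * y else 0) * x else 0) =
  if (i + j <= n)%N then F (n - (i + j))%N * (y * x) else 0.
Proof.
have [le_in|lt_ni] := leqP i n; last first.
  by rewrite leqNgt (leq_trans lt_ni) // leq_addr.
by rewrite leq_subRL // subnDA; case: ifP; rewrite ?mul0r ?mulrA.
Qed.

Lemma grade_e_actC i j F :
  e_act grade_act i (e_act grade_act j F) = e_act grade_act j (e_act grade_act i F).
Proof.
have actE k l n : e_act grade_act k (e_act grade_act l F) n =
    if (k + l <= n)%N then F (n - (k + l))%N * (e l * e k) else 0.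
  rewrite (grade_e_act k) (grade_e_act l F).
  exact: shift_mulA.
apply: funext => n; rewrite (actE i j) (actE j i) (addnC j i).
by rewrite (Tbar_eC K j i).
Qed.

Lemma Tbar_grading : exists gpart : nat -> Tb -> Tb,
  [/\ forall n, linear (gpart n),
      forall n, gpart n 1 = if n == 0%N then 1 else 0,
      forall n x, gpart n (x * gbar) = gpart n x * gbar
    & forall n x, gpart n (x * hbar) = if n is n'.+1 then gpart n' x * hbar else 0].
Proof.
have [f [fl f1 fg fh _]] := Tbar_act (fun n : nat => if n == 0%N then 1 else 0 : Tb)
  grade_act_linear grade_e_actC.
exists (fun n x => f x n); split=> [n a x y|n|n x|n x].
- by rewrite fl.
- by rewrite f1.
- by rewrite fg.
- by rewrite fh.
Qed.

Section Homogeneous.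
Variable gpart : nat -> Tb -> Tb.
Hypothesis gpart_linear : forall n, linear (gpart n).
Hypothesis gpart1 : forall n, gpart n 1 = if n == 0%N then 1 else 0.
Hypothesis gpart_g : forall n x, gpart n (x * gbar) = gpart n x * gbar.
Hypothesis gpart_h : forall n x,
  gpart n (x * hbar) = if n is n'.+1 then gpart n' x * hbar else 0.

Lemma homogT_word v : homogT (count_mem letter_h v) (word K v).
Proof. by move=> u; rewrite msuppU1 in_fset1 => /eqP ->. Qed.

Lemma homogT_subspace n : is_subspace (@homogT K n).
Proof.
split=> [v|a x y hx hy v]; first by rewrite msupp0 in_fset0.
move=> /(fsubsetP (msuppD_le _ _)); rewrite in_fsetU => /orP [|/hy //].
by move=> /(fsubsetP (msuppZ_le _ _)) /hx.
Qed.

Lemma homogT_mul_word n v x : homogT n x ->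
  homogT (n + count_mem letter_h v)%N (x * word K v).
Proof.
move=> hx u /msuppM_le [u1 [u2 [/hx <-]]].
rewrite msuppU1 in_fset1 => /eqP -> ->.
by rewrite fmM count_cat.
Qed.

(** An element is homogeneous of degree n exactly when it has a homogeneous
    representative: the components of any element have one, by induction. *)
Lemma homog_proj n x : homog gpart n x <-> (pr @` homogT n) x.
Proof.
have cg : count_mem letter_h [:: letter_g] = 0%N by [].
have ch : count_mem letter_h [:: letter_h] = 1%N by [].
have HS k : is_subspace (pr @` @homogT K k).
  have [h0 hP] := homogT_subspace k.
  split=> [|a _ _ [x1 h1 <-] [x2 h2 <-]].
    by exists 0 => //; apply: linear_fun0 (@proj_linear K).
  by exists (a *: x1 + x2); [apply: hP|rewrite proj_linear].
have HM k v y : (pr @` homogT k) y ->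
    (pr @` homogT (k + count_mem letter_h v)%N) (y * pr (word K v)).
  move=> [z hz <-]; exists (z * word K v); last by rewrite projM.
  exact: homogT_mul_word.
split=> [hx|[y hy <-]].
  have main z k : (pr @` homogT k) (gpart k z).
    elim/Tbar_ind: z k => [a z z' Hz Hz' k|k|z Hz k|z Hz k].
    - by rewrite gpart_linear; apply: (HS k).2.
    - rewrite gpart1; case: eqP => [->|_]; last exact: (HS k).1.
      by exists (word K [::]); [exact: homogT_word|rewrite word_nil proj1].
    - rewrite gpart_g; have := HM k [:: letter_g] _ (Hz k).
      by rewrite cg addn0; apply.
    - rewrite gpart_h; case: k => [|k]; first exact: (HS 0%N).1.
      have := HM k [:: letter_h] _ (Hz k).
      by rewrite ch addn1; apply.
  by have := main x n; rewrite hx eqxx.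
have cS := homog_subspace gpart_linear n.
rewrite [y]monalgE (linear_fun_sum (@proj_linear K)) big_seq.
apply: (subspace_sum cS) => v vy.
have -> : << y@_v *g v >> = y@_v *: word K v.
  by apply/malgP => u; rewrite mcoeffZ /word fmK !mcoeffU mulr_natr.
rewrite (linear_funZ (@proj_linear K)); apply: (subspaceZ cS).
rewrite -(hy v vy); elim/last_ind: (v : seq bool) => [|u l IH].
  by rewrite word_nil proj1; apply: homog1.
rewrite -cats1 count_cat wordM projM; case: l.
  rewrite ch addn1.
  exact: (homog_mulh (@Tbar_ind K) gpart_linear gpart1 gpart_g gpart_h IH).
rewrite cg addn0.
exact: (homog_mulg (@Tbar_ind K) gpart_linear gpart1 gpart_g gpart_h IH).
Qed.

End Homogeneous.

Lemma BF_fdb_ext : @BF K = fdb_ext gbar hbar.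
Proof.
by rewrite /BF /fdb_ext; congr subalg_gen; apply/seteqP; split=> x [n nx];
  exists n; move: nx; rewrite omegatE EomegaE.
Qed.

Lemma Emonom_emon s : Emonom K s = ad_mon gbar hbar s.
Proof. by apply: eq_bigr => p _; rewrite EomegaE. Qed.

(** The two descriptions differ by the monomials g a^mu, which are also of the
    form a_0 a^mu. *)
Lemma PBW_BF_ext_basis : @PBW_BF K = ext_basis gbar hbar.
Proof.
apply/seteqP; split=> x.
  move=> [m [[|[|d]] [s [m1 // _ ds ->]]]]; rewrite Emonom_emon.
    by left; exists s; rewrite ?expr0 ?mul1r.
  by right; exists m, s; rewrite expr1 omegatE.
move=> [[s ds ->]|[[|m] [s [ds ->]]]].
- by exists 1%N, 0%N, s; rewrite Emonom_emon expr0 mul1r.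
- have [t dt tE] := emon_decreasing (@Tbar_eC K) ((0%N, 1%N) :: s).
  exists 1%N, 0%N, t; rewrite Emonom_emon -tE expr0 mul1r.
  by split=> //; rewrite /ad_mon big_cons /= expr1 w0.
- by exists m.+1, 1%N, s; rewrite Emonom_emon expr1 omegatE.
Qed.

Lemma PBW_BFdB_basis : @PBW_BFdB K = [set 1] `|` gh_mons gbar hbar.
Proof.
apply/seteqP; split=> x.
  move=> [->|[m [s [ds ->]]]]; first by left.
  by right; exists m, s; rewrite omegatE Emonom_emon.
move=> [->|[m [s [ds ->]]]]; first by left.
by right; exists m, s; rewrite omegatE Emonom_emon.
Qed.

Lemma proj_BFdB : pr @` @BFdB K = fdb_alg gbar hbar.
Proof.
apply/seteqP; split=> [_ [x Bx <-]|x Sx].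
  have: [set y | fdb_alg gbar hbar (pr y)] x; last by [].
  move: x Bx; apply: subalg_gen_sub => [|_ [n ->] /=].
    apply: preim_subalg (subalg_gen_subalg _); first exact: proj_linear.
    by split; [exact: proj1|exact: projM].
  by rewrite -[pr _]/(omegat K n) omegatE; apply: w_fdb_alg.
have [[T0 TS] T1 TM] := subalg_gen_subalg [set x | exists n, x = word K (omega n)].
move: x Sx; apply: subalg_gen_sub => [|_ [n ->]].
  split=> [||_ _ [x Bx <-] [y By <-]].
  - split=> [|a _ _ [x Bx <-] [y By <-]].
      by exists 0 => //; apply: linear_fun0 (@proj_linear K).
    by exists (a *: x + y); [apply: TS|rewrite proj_linear].
  - by exists 1 => //; apply: proj1.
  - by exists (x * y); [apply: TM|rewrite projM].
exists (word K (omega n)); first by apply: sub_subalg_gen; exists n.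
by rewrite -omegatE.
Qed.

(** The orbit map of 1 in the polynomial representation of the quotient. *)
Lemma Tbar_model : exists phi : Tb -> {malg K[{cmonom nat}]},
  [/\ linear phi, phi 1 = 1, forall x, phi (x * gbar) = model_act letter_g (phi x)
    & forall x, phi (x * hbar) = model_act letter_h (phi x)].
Proof.
have [f [fl f1 fg fh _]] := Tbar_act (1 : {malg K[{cmonom nat}]})
  (@model_act_linear K) (@model_e_actC K).
by exists f.
Qed.

End Quotient.

Theorem theorem2p23 (K : fieldType) :
  [/\ is_quotient_bialgebra K,
      is_subbialgebra (@DeltaTbar K) (@BF K),
      is_grading (@DeltaTbar K) (@epsTbar K) (@BF K) (@BF_deg K)
        /\ (forall n, @BF_deg K n (omegat K n) /\ @BF_deg K n (Eomega K n)),
      is_pointed (@DeltaTbar K) (@epsTbar K) (@BF K)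
    & is_basis (@BF K) (@PBW_BF K)]
  /\ (forall m n r s : nat,
      [/\ Eomega K m * Eomega K n = Eomega K n * Eomega K m,
          Eomega K m * omegat K n =
            \sum_(k < n.+1) (omegat K (n - k) * Eomega K (m + k)) *+ 'C(n, k),
          omegat K m * omegat K n =
            \sum_(k < n.+1) (omegat K (m + n - k) * Eomega K k) *+ 'C(n, k)
        & omegat K r * Eomega K s =
            \sum_(t < s.+1)
              (-1) ^+ t * (omegat K (r + t) * omegat K (s - t)) *+ 'C(s, t)])
  /\ [/\ is_subbialgebra (@DeltaTbar K) (@proj K @` @BFdB K),
         @proj K @` @BFdB K `<=` @BF K
       & is_basis (@proj K @` @BFdB K) (@PBW_BFdB K)].
Proof.
have eC := @Tbar_eC K; have ind := @Tbar_ind K.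
have [Dl D1 Dg Dh Dp] := DeltaTbar_spec K.
have [el e1 eg eh] := epsTbar_spec K.
have [gpart [cl c1 cg ch]] := Tbar_grading K.
have [phi [pl p1 pg ph]] := Tbar_model K.
have indep := ext_basis_indep eC pl p1 pg ph.
have degE : @BF_deg K = ext_deg (gbar K) (hbar K) gpart.
  apply: funext => n; rewrite /BF_deg BF_fdb_ext; congr (_ `&` _).
  by apply/seteqP; split=> x /(homog_proj cl c1 cg ch n x).
split; [split|split=> [m n r s|]].
- split; [|exact: Dp|exact: epsTbar_proj].
  exact: generated_bialgebra ind Dl D1 Dg Dh el e1 eg eh.
- by rewrite BF_fdb_ext; apply: fdb_ext_subbialgebra ind Dl D1 Dg Dh cl c1 cg ch eC.
- rewrite degE BF_fdb_ext; split.
    exact: (fdb_ext_grading ind Dl D1 Dg Dh el eg eh cl c1 cg ch eC).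
  move=> n; rewrite omegatE EomegaE; split; split.
  + exact: w_fdb_ext.
  + exact: (homog_w ind cl c1 cg ch).
  + exact: e_fdb_ext.
  + exact: (homog_e ind cl c1 cg ch).
- rewrite BF_fdb_ext.
  exact: (fdb_ext_pointed ind Dl D1 Dg Dh el e1 eg eh cl c1 cg ch eC pl p1 pg ph).
- rewrite BF_fdb_ext PBW_BF_ext_basis; split=> //; exact: ext_basis_span.
- split; rewrite ?EomegaE ?omegatE.
  + exact: eC.
  + rewrite (e_mulw _ _ eC); apply: eq_bigr => k _.
    by rewrite omegatE EomegaE.
  + by rewrite w_mulw; apply: eq_bigr => k _; rewrite omegatE EomegaE.
  + by rewrite w_mule; apply: eq_bigr => t _; rewrite !omegatE.
rewrite proj_BFdB PBW_BFdB_basis BF_fdb_ext; split.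
- exact: (fdb_alg_subbialgebra ind Dl D1 Dg Dh cl c1 cg ch).
- exact: fdb_alg_ext.
split; first exact: fdb_basis_span.
apply: lin_indepS indep => x [->|wx]; last by right.
left; have := emons_emon eC [::]; by rewrite /ad_mon big_nil.
Qed.
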